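(* Let $n\ge1$. For each $\mu\in\mathbb{Z}_{\ge0}^n$, the type $\mathrm{GL}_n$ affine Demazure character $E_\mu(x;q,0)$ has M-convex support for generic $q$. In particular, it has the saturated Newton polytope property: $\mathrm{conv}(\mathrm{supp}(E_\mu(x;q,0)))\cap\mathbb{Z}^n=\mathrm{supp}(E_\mu(x;q,0))$.
   Context: The type $\mathrm{GL}_n$ affine Demazure character attached to $\mu$ is the specialization at $t=0$ of the non-symmetric Macdonald polynomial $E_\mu(x_1,\dots,x_n;q,t)$ defined as follows. **Diagrams and fillings.** For a weak composition $\mu\in\mathbb{Z}_{\ge0}^n$ let $dg'(\mu)=\{(i,j):1\le i\le n,\ 1\le j\le\mu_i\}$ ($i$ is the column, $j$ the row) and $\widehat{dg}(\mu)=dg'(\mu)\cup\{(i,0):1\le i\le n\}$. A filling is a map $\sigma:dg'(\mu)\to\{1,\dots,n\}$; its augmented filling $\widehat\sigma$ on $\widehat{dg}(\mu)$ extends $\sigma$ by $\widehat\sigma(i,0)=i$. Two distinct boxes attack each other if they are in the same row, or they are in consecutive rows and the box in the lower row is in a column strictly to the right of that of the box in the upper row. $\sigma$ is non-attacking if $\widehat\sigma(u)\ne\widehat\sigma(v)$ for all attacking pairs $u,v\in\widehat{dg}(\mu)$. Put $x^\sigma=\prod_{u\in dg'(\mu)}x_{\sigma(u)}$. **Statistics.** For $u=(i,j)\in dg'(\mu)$ let $d(u)=(i,j-1)$, $l(u)=\mu_i-j$, and $a(u)=\#\{(i',j)\in dg'(\mu):i'<i,\ \mu_{i'}\le\mu_i\}+\#\{(i',j-1)\in\widehat{dg}(\mu):i'>i,\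 \mu_{i'}<\mu_i\}$. Let $\mathrm{Des}(\widehat\sigma)=\{u\in dg'(\mu):\widehat\sigma(u)>\widehat\sigma(d(u))\}$. The reading order goes row by row from top to bottom, right to left within each row; $\mathrm{Inv}(\widehat\sigma)$ is the set of attacking pairs $u,v\in\widehat{dg}(\mu)$ with $u$ before $v$ in reading order and $\widehat\sigma(u)>\widehat\sigma(v)$. Set $\mathrm{maj}(\widehat\sigma)=\sum_{u\in\mathrm{Des}(\widehat\sigma)}(l(u)+1)$, $\mathrm{inv}(\widehat\sigma)=|\mathrm{Inv}(\widehat\sigma)|-|\{i<j:\mu_i\le\mu_j\}|-\sum_{u\in\mathrm{Des}(\widehat\sigma)}a(u)$, $\mathrm{coinv}(\widehat\sigma)=\sum_{u\in dg'(\mu)}a(u)-\mathrm{inv}(\widehat\sigma)$. Then $$E_\mu(x;q,t)=\sum_{\sigma\ \text{non-attacking}}x^\sigma q^{\mathrm{maj}(\widehat\sigma)}t^{\mathrm{coinv}(\widehat\sigma)}\prod_{u\in dg'(\mu),\ \widehat\sigma(u)\ne\widehat\sigma(d(u))}\frac{1-t}{1-q^{l(u)+1}t^{a(u)+1}}.$$ $E_\mu(x;q,0)$ is obtained by setting $t=0$; ''generic $q$'' means $q$ is treated as an indeterminate. **Support.** For a polynomial $f$ in $x_1,\dots,x_n$, $\mathrm{supp}(f)=\{\alpha\in\mathbb{Z}^n: x^\alpha\text{ has nonzero coefficient in }f\}$. **M-convexity.** A polytope $P\subset\mathbb{R}^n$ is a generalized permutahedron if for every pair of adjacent vertices $\mathbf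 u,\mathbf v$ of $P$ there are $i,j\in[n]$ with $\mathbf u-\mathbf v\in\mathrm{span}(e_i-e_j)$. A set $S\subseteq\mathbb{Z}^n$ is M-convex if $S=P\cap\mathbb{Z}^n$ for some generalized permutahedron $P$ with all vertices in $\mathbb{Z}^n$. *)

(* Defs.v *)
From HB Require Import structures.
From mathcomp Require Import all_boot all_order all_algebra.
From mathcomp Require Import mpoly.
From mathcomp Require Import classical_sets reals convex.

Set Implicit Arguments.
Unset Strict Implicit.
Unset Printing Implicit Defensive.

Import GRing.Theory.

Section Fillings.
Local Open Scope nat_scope.

(* Columns and filling values, {1, ..., n} on paper, are both 'I_n, that is    *)
(* {0, ..., n - 1}: they are only ever compared with each other.               *)
Variables (n : nat) (mu : 'I_n -> nat).

(* The augmented diagram: column i has the rows 0, ..., mu i.                  *)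
Definition abox := {i : 'I_n & 'I_(mu i).+1}.
Definition col (u : abox) : 'I_n := tag u.
Definition row (u : abox) : nat := tagged u.

(* The diagram dg'(mu): rows keep their numbering 1, ..., mu i.                *)
Definition box := {u : abox | 0 < row u}.

Definition filling := {ffun box -> 'I_n}.

(* insub u is None exactly when u lies in row 0.                               *)
Definition augment (sigma : filling) (u : abox) : 'I_n :=
  oapp sigma (col u) (insub u).

Definition below (u : box) : abox :=
  Tagged (fun i => 'I_(mu i).+1) (inord (row (val u)).-1 : 'I_(mu (col (val u))).+1).

Definition attack (u v : abox) : bool :=
  (u != v) &&
  [|| row u == row v,
      (row u == (row v).+1) && (col u < col v) |
      (row v == (row u).+1) && (col v < col u)].

Definition nonattacking (sigma : filling) : bool :=
  [forall u, forall v, attack u v ==> (augment sigma u != augment sigma v)].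

Definition leg (u : box) : nat := mu (col (val u)) - row (val u).

Definition arm (u : box) : nat :=
  #|[set v : box | [&& row (val v) == row (val u),
                       col (val v) < col (val u) &
                       mu (col (val v)) <= mu (col (val u))]]|
  + #|[set v : abox | [&& (row v).+1 == row (val u),
                          col (val u) < col v &
                          mu (col v) < mu (col (val u))]]|.

Definition Des (sigma : filling) : {set box} :=
  [set u : box | augment sigma (below u) < augment sigma (val u)].

Definition reads_before (u v : abox) : bool :=
  (row v < row u) || (row u == row v) && (col v < col u).

Definition Inv (sigma : filling) : {set abox * abox} :=
  [set p | [&& attack p.1 p.2, reads_before p.1 p.2 &
               augment sigma p.2 < augment sigma p.1]].

Definition maj (sigma : filling) : nat := \sum_(u in Des sigma) (leg u).+1.

Local Open Scope ring_scope.

Definition inv (sigma : filling) : int :=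
  #|Inv sigma|%:Z
  - #|[set p : 'I_n * 'I_n | (p.1 < p.2)%N && (mu p.1 <= mu p.2)%N]|%:Z
  - \sum_(u in Des sigma) (arm u)%:Z.

Definition coinv (sigma : filling) : int := \sum_(u : box) (arm u)%:Z - inv sigma.

(* E_mu(x; q, t), for parameters q, t in any field. The power t ^ coinv has an *)
(* integer exponent; coinv is nonnegative on non-attacking fillings (it counts *)
(* coinversion triples), so t = 0 is a legitimate value, with 0 ^ 0 = 1.       *)
Definition macdonaldE (K : fieldType) (q t : K) : {mpoly K[n]} :=
  \sum_(sigma : filling | nonattacking sigma)
    (q ^+ maj sigma * t ^ coinv sigma
     * \prod_(u : box | augment sigma (val u) != augment sigma (below u))
         ((1 - t) / (1 - q ^+ (leg u).+1 * t ^+ (arm u).+1)))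
    *: \prod_(u : box) 'X_(sigma u).

(* q is the indeterminate of Q(q). *)
Definition demazureE : {mpoly {fraction {poly rat}}[n]} :=
  macdonaldE (tofrac 'X) 0.

End Fillings.

Section Convexity.
Local Open Scope ring_scope.
Local Open Scope classical_set_scope.

Definition supp (n : nat) (K : fieldType) (f : {mpoly K[n]}) : set 'rV[int]_n :=
  [set \row_i (m i)%:Z | m in [set m : 'X_{1..n} | f@_m != 0]].

Variables (R : realType) (n : nat).
Implicit Types (P F A : set 'rV[R]_n) (u v : 'rV[R]_n) (S : set 'rV[int]_n).

Definition conv A : set 'rV[R]_n := smallest (@convex_set R 'rV[R]_n) A.

Definition polytope P : Prop := exists s : seq 'rV[R]_n, P = conv [set` s].

Definition dot u v : R := \sum_i u 0 i * v 0 i.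

(* A nonempty F is a face when some linear functional is maximised over P      *)
(* exactly on F.                                                               *)
Definition face P F : Prop :=
  exists c : 'rV[R]_n, F = [set x | P x /\ forall y, P y -> dot c y <= dot c x].

Definition vertex P v : Prop := face P [set v].

Definition adjacent P u v : Prop :=
  [/\ vertex P u, vertex P v, u <> v & face P (conv [set u; v])].

Definition generalized_permutahedron P : Prop :=
  polytope P /\
  forall u v, adjacent P u v ->
    exists (i j : 'I_n) (k : R), u - v = k *: (delta_mx 0 i - delta_mx 0 j).

Definition of_int (a : 'rV[int]_n) : 'rV[R]_n := map_mx intr a.

Definition M_convex S : Prop :=
  exists P, [/\ generalized_permutahedron P,
                forall v, vertex P v -> range of_int v &
                S = of_int @^-1` P].

Definition saturated_newton_polytope (K : fieldType) (f : {mpoly K[n]}) : Prop :=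
  of_int @^-1` (conv (of_int @` supp f)) = supp f.

End Convexity.

(* Main.v *)
Require Import Defs.
From mathcomp Require Import all_boot all_order all_algebra.
From mathcomp Require Import perm mpoly.
From mathcomp Require Import boolp classical_sets reals interval_inference.
From mathcomp Require Import zify ring lra.

(* At t = 0 only the non-attacking fillings with coinv = 0 survive, each with  *)
(* coefficient q ^ maj, so the support is the set of their contents.           *)
(*                                                                             *)
(* Read a filling as n particles on the cycle Z/n: the particle of column i    *)
(* starts at site i and, row after row (left to right within a row), moves to  *)
(* the entry of its next box, until it runs out of boxes and disappears.       *)
(* Non-attacking means that two living particles never share a site, and       *)
(* coinv = 0 means that a particle, moving cyclically downwards, never passes  *)
(* one that disappears before it.  This picture is invariant under rotation.   *)
(*                                                                             *)
(* The contents are the beta below mu in the affine Bruhat order, that is      *)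
(* sum beta = sum mu and, for all c,                                           *)
(*   sum_i (beta_i - thr c i)^+ <= sum_i (mu_i - thr c i)^+.                   *)
(* Necessity: two landings on a site are at least n time steps apart.          *)
(* Sufficiency, by induction: if mu_0 > 0, the first particle cannot move and  *)
(* one rotates. Otherwise let b be the first nonempty column and a = b - 1.    *)
(* Then beta or its image under the swap of a and b lies below the mu with     *)
(* columns a and b swapped, whose contents are contents of mu; and the set of  *)
(* contents of mu is invariant under the swap of a and b. Indeed, the          *)
(* generating function of the runs from a configuration with b occupied and a  *)
(* free is the image of the one with a occupied and b free under the isobaric  *)
(* divided difference operator, hence symmetric in x_a and x_b.                *)
(*                                                                             *)
(* Finally these inequalities read sum_(i in I) beta_i <= capacity c I with    *)
(* min_c (capacity c I) submodular in I, so the set is M-convex by symmetric   *)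
(* exchange, which also gives the edge directions of its convex hull.          *)

Set Implicit Arguments.
Unset Strict Implicit.
Unset Printing Implicit Defensive.

Import Order.TTheory GRing.Theory Num.Theory.

(** * Particles on a cycle *)

(** The support is an explicit set of integer points, the vectors dominated by [mu], and both claims
    are read off its inequalities. [supp_demazureE] identifies the two sets. Coefficients cannot
    cancel, so the support consists of contents of fillings. [weight_dominated] bounds these
    contents; conversely, [dominated_reaches] finds a run for each dominated vector, and
    [run_filling] turns runs into fillings.

    The hard input is [run_sym], the symmetry of contents under exchanging two adjacent sites. It
    rests on [demazure_relations], four identities proved by one induction because a single move
    mixes them.

    On the convex side, [exchange] uncrosses tight constraints, [adjacent_direction] derives the
    edge directions from it, and [lattice_points] excludes further integer points. *)

Section Queue.
Variable n : nat.
Local Open Scope nat_scope.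

(** Length of the downward walk from [w] to [v] around the cycle. *)
Definition dist (w v : 'I_n) : nat := (w + n - v) %% n.

(* A configuration is a queue of particles (site, number of moves left), next  *)
(* to act first; an acting particle with no move left disappears.  As moved    *)
(* particles go to the back of the queue, p disappears before the acting       *)
(* particle (w, h) iff p.2 < h, and only such a p blocks its way.              *)
Definition particle := ('I_n * nat)%type.
Implicit Types (q r : seq particle) (p : particle).

Definition allowed (w : 'I_n) (h : nat) q (u : 'I_n) : bool :=
  (u \notin map fst q) &&
  all (fun p => (p.2 < h) ==> (dist w u < dist w p.1)) q.

Lemma distE (w v : 'I_n) : dist w v = if v <= w then w - v else w + n - v.
Proof.
rewrite /dist; have := ltn_ord w; have := ltn_ord v => hv hw.
case: leqP => h; last by rewrite modn_small //; lia.
by rewrite (_ : w + n - v = (w - v) + n) ?modnDr ?modn_small //; lia.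
Qed.

Lemma dist_refl (w : 'I_n) : dist w w = 0.
Proof. by rewrite distE leqnn subnn. Qed.

Lemma dist_inj (w u v : 'I_n) : dist w u = dist w v -> u = v.
Proof.
have := ltn_ord u; have := ltn_ord v; have := ltn_ord w.
rewrite !distE => hw hu hv h; apply: val_inj => /=.
by move: h; do 2!case: ifP => ?; lia.
Qed.

Lemma allowed_cons w h p q u :
  allowed w h (p :: q) u =
  [&& u != p.1, (p.2 < h) ==> (dist w u < dist w p.1) & allowed w h q u].
Proof.
rewrite /allowed /= inE negb_or -!andbA; congr (_ && _).
by rewrite !andbA; congr (_ && _); rewrite andbC.
Qed.

Lemma allowed_cat w h q1 q2 u :
  allowed w h (q1 ++ q2) u = allowed w h q1 u && allowed w h q2 u.
Proof.
by rewrite /allowed map_cat mem_cat negb_or all_cat !andbA; congr (_ && _);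
   rewrite -!andbA; congr (_ && _); rewrite andbC.
Qed.

Section Adjacent.
Variables a b : 'I_n.
Hypothesis hab : b = a.+1 :> nat.

Lemma adj_neq : a != b. Proof. by rewrite -val_eqE /= hab; lia. Qed.

Definition off_pair (u : 'I_n) := (u != a) && (u != b).

Lemma dist_step (w : 'I_n) : w != a -> dist w a = (dist w b).+1.
Proof.
move=> wa; have := ltn_ord w; have := ltn_ord b; have := wa.
rewrite -val_eqE /= !distE hab => ne hb hw.
by do 2!case: ifP => ?; lia.
Qed.

Lemma dist_from (v : 'I_n) : v != b -> dist b v = (dist a v).+1.
Proof.
move=> vb; have := ltn_ord v; have := ltn_ord b; have := vb.
rewrite -val_eqE /= !distE hab => ne hb hw.
by do 2!case: ifP => ?; lia.
Qed.

Definition avoid_pair q := all (fun p => off_pair p.1) q.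

Lemma off_a : off_pair a = false. Proof. by rewrite /off_pair eqxx. Qed.
Lemma off_b : off_pair b = false. Proof. by rewrite /off_pair eqxx andbF. Qed.

Lemma avoid_notin q : avoid_pair q -> (a \notin map fst q) && (b \notin map fst q).
Proof.
elim: q => //= p q IH /andP[/andP[pa pb] /IH /andP[ha hb]].
by rewrite !inE !negb_or ha hb (eq_sym a) (eq_sym b) pa pb.
Qed.

(** A downward walk with both ends off the pair passes both neighbouring sites or neither, so it
    cannot tell which one is occupied. *)
Lemma allowed_third w h k q1 q2 u : off_pair w -> off_pair u ->
  allowed w h (q1 ++ (a, k) :: q2) u = allowed w h (q1 ++ (b, k) :: q2) u.
Proof.
move=> ow ou; suff e : (dist w u < dist w a) = (dist w u < dist w b).
  by rewrite !allowed_cat !allowed_cons /= e; case/andP: (ou) => -> ->.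
have /andP[wa _] := ow; have /andP[_ ub] := ou; rewrite dist_step //.
have : dist w u != dist w b by apply: contraNneq ub => /dist_inj ->.
by lia.
Qed.

Lemma allowed_hole w h q : off_pair w -> avoid_pair q -> allowed w h q a = allowed w h q b.
Proof.
move=> /andP[wa _]; elim: q => // -[v k] q IH /andP[/= /andP[va vb] /IH{}IH].
rewrite !allowed_cons IH /= dist_step // (eq_sym a) (eq_sym b) va vb /=.
suff -> : ((dist w b).+1 < dist w v) = (dist w b < dist w v) by [].
have : dist w v != dist w a by apply: contraNneq va => /dist_inj ->.
by rewrite dist_step //; lia.
Qed.

Lemma allowed_from h q u : avoid_pair q -> off_pair u -> allowed a h q u = allowed b h q u.
Proof.
move=> + /andP[ua ub]; elim: q => // -[v k] q IH /andP[/= /andP[va vb] /IH{}IH].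
by rewrite !allowed_cons IH /= !dist_from.
Qed.

Lemma allowed_stay w h q : w \notin map fst q -> allowed w h q w.
Proof.
elim: q => // -[v k] q IH; rewrite inE negb_or => /andP[/= wv /IH{}IH].
rewrite allowed_cons IH wv dist_refl andbT /=; apply/implyP => _.
by rewrite lt0n; apply: contraNneq wv => h0; apply/eqP/(@dist_inj w); rewrite dist_refl.
Qed.

Lemma allowed_stay_a h q : avoid_pair q -> allowed a h q a.
Proof. by move=> /avoid_notin/andP[ha _]; exact: allowed_stay. Qed.

Lemma allowed_stay_b h q : avoid_pair q -> allowed b h q b.
Proof. by move=> /avoid_notin/andP[_ hb]; exact: allowed_stay. Qed.

Lemma allowed_down h q : avoid_pair q -> allowed b h q a.
Proof.
elim: q => // -[v k] q IH /andP[/= /andP[va vb] /IH{}IH].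
rewrite allowed_cons IH eq_sym va andbT /=; apply/implyP => _.
rewrite (dist_from adj_neq) dist_refl dist_from // ltnS lt0n.
by apply: contraNneq va => h0; apply/eqP/(@dist_inj a); rewrite dist_refl.
Qed.

End Adjacent.
End Queue.

(** * Isobaric divided differences on generating functions of runs *)

Section Weights.
Variable n : nat.
Local Open Scope ring_scope.
Implicit Types (q r : seq (particle n)).

(* Generating function of the runs from q.  Returning 0, not 1, when the fuel  *)
(* k runs out makes all the relations below hold for k = 0.                    *)
Fixpoint F (R : comNzRingType) (X : 'I_n -> R) k q : R :=
  if k is k'.+1 then
    match q with
    | [::] => 1
    | (w, 0%N) :: r => F X k' r
    | (w, h.+1) :: r =>
        \sum_(u | allowed w h.+1 r u) X u * F X k' (rcons r (u, h))
    end
  else 0.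

Variables (R : idomainType) (a b : 'I_n).
Hypothesis hab : b = a.+1 :> nat.
Local Notation off := (off_pair a b).
Local Notation avoid := (avoid_pair a b).

Definition swapped (X Y : 'I_n -> R) : Prop :=
  [/\ Y a = X b, Y b = X a & forall u, off u -> Y u = X u].

Lemma swappedC X Y : swapped X Y -> swapped Y X.
Proof. by case=> ha hb h; split=> // u /h. Qed.

Lemma sum_off (P : pred 'I_n) (G : 'I_n -> R) :
  \sum_(u | P u) G u = \sum_(u | P u && off u) G u
    + (if P a then G a else 0) + (if P b then G b else 0).
Proof.
rewrite (bigID off) /= -addrA; congr (_ + _).
rewrite (bigID (pred1 a)) /=; congr (_ + _).
  case: ifP => Pa.
    rewrite (big_pred1 a) // => u /=; case: eqP => [->|_]; last by rewrite andbF.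
    by rewrite Pa off_a.
  by rewrite big_pred0 // => u; case: eqP => [->|_]; rewrite ?Pa ?andbF.
case: ifP => Pb.
  rewrite (big_pred1 b) // => u /=; case: (eqVneq u b) => [->|ub].
    by rewrite Pb off_b eq_sym (adj_neq hab).
  by rewrite /off_pair ub andbT; case: (u == a); rewrite ?andbF.
rewrite big_pred0 // => u /=; case: (eqVneq u b) => [->|ub]; first by rewrite Pb.
by rewrite /off_pair ub andbT; case: (u == a); rewrite ?andbF.
Qed.

(* Write x = X a, y = X b, and f^s for f at the weights Y, which are X with x  *)
(* and y exchanged.  With pi f = (x f - y f^s) / (x - y), lone and small_first *)
(* read F(a and b exchanged) = pi F, and big_first reads F(a and b exchanged)  *)
(* = (pi - 1) F together with the fact that this is y times a symmetric        *)
(* function.  The particle moving first disappears first in small_first, last  *)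
(* in big_first.                                                               *)
Definition sym0 k := forall X Y q, swapped X Y -> X a != X b -> avoid q ->
  F Y k q = F X k q.

Definition lone k := forall X Y q1 q2 h, swapped X Y -> X a != X b ->
  avoid q1 -> avoid q2 ->
  (X a - X b) * F X k (q1 ++ (b, h) :: q2) =
  X a * F X k (q1 ++ (a, h) :: q2) - X b * F Y k (q1 ++ (a, h) :: q2).

Definition small_first k := forall X Y q1 q2 q3 ka kb, swapped X Y -> X a != X b ->
  avoid q1 -> avoid q2 -> avoid q3 -> (kb <= ka)%N ->
  (X a - X b) * F X k (q1 ++ (a, kb) :: q2 ++ (b, ka) :: q3) =
  X a * F X k (q1 ++ (b, kb) :: q2 ++ (a, ka) :: q3)
  - X b * F Y k (q1 ++ (b, kb) :: q2 ++ (a, ka) :: q3).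

Definition big_first k := forall X Y q1 q2 q3 ka kb, swapped X Y -> X a != X b ->
  avoid q1 -> avoid q2 -> avoid q3 -> (kb < ka)%N ->
  X a * F X k (q1 ++ (b, ka) :: q2 ++ (a, kb) :: q3) =
  X b * F Y k (q1 ++ (b, ka) :: q2 ++ (a, kb) :: q3) /\
  X b * (F X k (q1 ++ (a, ka) :: q2 ++ (b, kb) :: q3)
         - F Y k (q1 ++ (a, ka) :: q2 ++ (b, kb) :: q3)) =
  (X a - X b) * F X k (q1 ++ (b, ka) :: q2 ++ (a, kb) :: q3).

Lemma swapped_neq X Y : swapped X Y -> X a != X b -> Y a != Y b.
Proof. by case=> -> -> _; rewrite eq_sym. Qed.

(** Images of the divided difference are symmetric: exchanging [x] and [y] negates both the
    numerator and [x - y]. *)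
Lemma demazure_sym (x y f fs g gs : R) : x != y ->
  (x - y) * g = x * f - y * fs -> (y - x) * gs = y * fs - x * f -> gs = g.
Proof.
move=> xy h1 h2; have nz : x - y != 0 by rewrite subr_eq0.
by apply: (mulfI nz); rewrite h1 -[x - y]opprB mulNr h2 opprB.
Qed.

(** Reduces a goal to a known relation with the same difference of sides, a check left to [ring]. *)
Lemma eq_of_sub (x y z t : R) : x = y -> z - t = x - y -> z = t.
Proof. by move=> -> /eqP; rewrite subrr subr_eq0 => /eqP. Qed.

Lemma lone_sym k X Y q1 q2 h : lone k -> swapped X Y -> X a != X b ->
  avoid q1 -> avoid q2 -> F Y k (q1 ++ (b, h) :: q2) = F X k (q1 ++ (b, h) :: q2).
Proof.
move=> L sXY xy a1 a2; have [Ya Yb _] := sXY.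
have := L _ _ q1 q2 h (swappedC sXY) (swapped_neq sXY xy) a1 a2.
rewrite Ya Yb; apply: (demazure_sym xy); exact: L.
Qed.

Lemma small_first_sym k X Y q1 q2 q3 ka kb : small_first k -> swapped X Y ->
  X a != X b -> avoid q1 -> avoid q2 -> avoid q3 -> (kb <= ka)%N ->
  F Y k (q1 ++ (a, kb) :: q2 ++ (b, ka) :: q3) =
  F X k (q1 ++ (a, kb) :: q2 ++ (b, ka) :: q3).
Proof.
move=> L sXY xy a1 a2 a3 kk; have [Ya Yb _] := sXY.
have := L _ _ q1 q2 q3 ka kb (swappedC sXY) (swapped_neq sXY xy) a1 a2 a3 kk.
rewrite Ya Yb; apply: (demazure_sym xy); exact: L.
Qed.

Arguments avoid_pair : simpl never.

Section Step.
Variable k : nat.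
Hypotheses (h0 : sym0 k) (h1 : lone k) (hs : small_first k) (hb : big_first k).

Lemma avoid_cons p q : avoid (p :: q) = off p.1 && avoid q. Proof. by []. Qed.

Lemma avoid_rcons q u h : avoid q -> off u -> avoid (rcons q (u, h)).
Proof. by rewrite /avoid_pair all_rcons /= => -> ->. Qed.

Lemma avoid_cat q1 q2 : avoid (q1 ++ q2) = avoid q1 && avoid q2.
Proof. exact: all_cat. Qed.

Lemma off_F_sum X Y (P : pred 'I_n) (G H : 'I_n -> R) : swapped X Y ->
  (forall u, off u -> G u = H u) ->
  \sum_(u | P u && off u) Y u * G u = \sum_(u | P u && off u) X u * H u.
Proof.
by case=> _ _ e eGH; apply: eq_bigr => u /andP[_ ou]; rewrite e // eGH.
Qed.

(** Landings on [a] and on [b] are allowed together, and [lone] says exactly that their joint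
    contribution is symmetric. *)
Lemma sym0_step : sym0 k.+1.
Proof.
move=> X Y [//|[w [|h]] r] sXY xy; rewrite avoid_cons => /andP[ow ar] /=; first exact: h0.
have [Ya Yb e] := sXY.
rewrite [LHS]sum_off [RHS]sum_off (allowed_hole hab) // (@off_F_sum X Y _ _ (fun u => F X k (rcons r (u, h)))) //.
  case: ifP => _ //.
  rewrite -!addrA; congr (_ + _); rewrite -!cats1 Ya Yb.
  have L := h1 h sXY xy ar (isT : avoid [::]); rewrite (lone_sym _ h1 sXY) //.
  by apply: (eq_of_sub L); ring.
by move=> u ou; apply: h0 => //; exact: avoid_rcons.
Qed.

Lemma lin_sum X (P : pred 'I_n) (f g g' : 'I_n -> R) (c d e : R) :
  (forall u, off u -> c * f u = d * g u - e * g' u) ->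
  c * (\sum_(u | P u && off u) X u * f u) =
  d * (\sum_(u | P u && off u) X u * g u) - e * (\sum_(u | P u && off u) X u * g' u).
Proof.
move=> h; rewrite !mulr_sumr -sumrB; apply: eq_bigr => u /andP[_ /h hu].
by rewrite mulrCA hu mulrBr !(mulrCA (X u)).
Qed.

Lemma off_sum_weight X Y (P : pred 'I_n) (G : 'I_n -> R) : swapped X Y ->
  \sum_(u | P u && off u) Y u * G u = \sum_(u | P u && off u) X u * G u.
Proof. by move=> sXY; exact: off_F_sum. Qed.

Lemma eq_off (P Q : pred 'I_n) (G : 'I_n -> R) : (forall u, off u -> P u = Q u) ->
  \sum_(u | P u && off u) G u = \sum_(u | Q u && off u) G u.
Proof.
by move=> e; apply: eq_bigl => u; case ou: (off u); rewrite ?andbF // e.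
Qed.

Lemma rcons_slot (q1 q2 : seq (particle n)) p z :
  rcons (q1 ++ p :: q2) z = q1 ++ p :: rcons q2 z.
Proof. by rewrite rcons_cat rcons_cons. Qed.

Lemma allowed_occupied (w v : 'I_n) h k' q1 q2 :
  allowed w h (q1 ++ (v, k') :: q2) v = false.
Proof. by rewrite allowed_cat allowed_cons eqxx andbF. Qed.

Lemma lone_step_head X Y q h : swapped X Y -> X a != X b -> avoid q ->
  (X a - X b) * F X k.+1 ((b, h) :: q) =
  X a * F X k.+1 ((a, h) :: q) - X b * F Y k.+1 ((a, h) :: q).
Proof.
move=> sXY xy aq; have [Ya Yb e] := sXY.
case: h => [|h] /=; first by rewrite (h0 sXY) // mulrBl.
rewrite !(sum_off (allowed b h.+1 q)) !(sum_off (allowed a h.+1 q)).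
rewrite (allowed_down hab) // (allowed_stay_a _ aq) (allowed_stay_b _ aq).
rewrite (@off_F_sum X Y _ _ (fun u => F X k (rcons q (u, h)))) //; last first.
  by move=> u ou; apply: h0 => //; exact: avoid_rcons.
rewrite (eq_off _ (fun u ou => allowed_from hab _ aq ou)) -!cats1 Ya Yb.
rewrite (lone_sym _ h1 sXY) //.
have L := h1 h sXY xy aq (isT : avoid [::]).
by case: ifP => _; apply: (eq_of_sub (congr1 ( *%R (X b)) L)); ring.
Qed.

(** If a third particle acts first, it may land on the free site of the pair. Then two particles
    hold the pair, and [small_first] or [big_first] applies according to which disappears first. *)
Lemma lone_step : lone k.+1.
Proof.
move=> X Y [|[w h'] q1] q2 h sXY xy; first by move=> _; exact: lone_step_head.
rewrite avoid_cons => /andP[/= ow a1] a2; have [Ya Yb e] := sXY.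
case: h' => [|h']; first exact: h1.
have [wa wb] := andP ow; have a12 : avoid (q1 ++ q2) by rewrite avoid_cat a1.
have eb : allowed w h'.+1 (q1 ++ (a, h) :: q2) b = allowed w h'.+1 (q1 ++ q2) b.
  rewrite !allowed_cat allowed_cons /= eq_sym (adj_neq hab) (dist_step hab) //.
  by rewrite ltnSn implybT.
(* Reaching [a] means passing the particle at [b], which must not disappear first: hence
   [h' < h]. *)
have ea : allowed w h'.+1 (q1 ++ (b, h) :: q2) a =
          (h' < h)%N && allowed w h'.+1 (q1 ++ q2) b.
  rewrite -(allowed_hole hab _ ow) // !allowed_cat allowed_cons /= (adj_neq hab).
  rewrite (dist_step hab) // (_ : ((dist w b).+1 < dist w b)%N = false); last by lia.
  rewrite implybF -leqNgt.
  by case: (_ < _)%N; rewrite ?andbF.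
rewrite (sum_off (allowed w h'.+1 (q1 ++ (b, h) :: q2))).
rewrite !(sum_off (allowed w h'.+1 (q1 ++ (a, h) :: q2))) !allowed_occupied ea eb.
rewrite (off_sum_weight _ _ sXY) -(eq_off _ (fun u ou => allowed_third hab _ _ _ _ ow ou)).
have LS : forall u, off u -> (X a - X b) * F X k (rcons (q1 ++ (b, h) :: q2) (u, h')) =
   X a * F X k (rcons (q1 ++ (a, h) :: q2) (u, h')) -
   X b * F Y k (rcons (q1 ++ (a, h) :: q2) (u, h')).
  by move=> u ou; rewrite !rcons_slot (h1 h sXY) //; exact: avoid_rcons.
have {}LS := lin_sum X (allowed w h'.+1 (q1 ++ (a, h) :: q2)) LS.
rewrite !rcons_slot Yb; case: (allowed w _ (q1 ++ q2) b); last first.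
  by rewrite andbF; apply: (eq_of_sub LS); ring.
case: ltnP => hh /=.
  have [_ L] := hb sXY xy a1 a2 (isT : avoid [::]) hh.
  rewrite -!cats1 in L *.
  by apply: (eq_of_sub (f_equal2 +%R LS (congr1 ( *%R (- X a)) L))); ring.
have L := small_first_sym hs (swappedC sXY) (swapped_neq sXY xy) a1 a2 (isT : avoid [::]) hh.
by rewrite -!cats1 in LS L *; rewrite L; apply: (eq_of_sub LS); ring.
Qed.

Lemma allowed_third2 w h (q1 q2 q3 : seq (particle n)) k1 k2 u : off w -> off u ->
  allowed w h (q1 ++ (a, k1) :: q2 ++ (b, k2) :: q3) u =
  allowed w h (q1 ++ (b, k1) :: q2 ++ (a, k2) :: q3) u.
Proof.
move=> ow ou; rewrite (allowed_third hab) //.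
by rewrite -!cat_cons !catA -(allowed_third hab).
Qed.

Lemma allowed_occupied2 w h (q1 q2 q3 : seq (particle n)) p v k' :
  allowed w h (q1 ++ p :: q2 ++ (v, k') :: q3) v = false.
Proof. by rewrite -cat_cons catA allowed_occupied. Qed.

Lemma rcons_slot2 (q1 q2 q3 : seq (particle n)) p p' z :
  rcons (q1 ++ p :: q2 ++ p' :: q3) z = q1 ++ p :: q2 ++ p' :: rcons q3 z.
Proof. by rewrite !rcons_slot. Qed.

(** Without moves left, the first particle disappears and [lone] remains. If it moves within the
    pair, it goes to the back of the queue and the particle of the pair now in front disappears
    last, hence [big_first]. *)
Lemma small_first_head X Y q2 q3 ka kb : swapped X Y -> X a != X b ->
  avoid q2 -> avoid q3 -> (kb <= ka)%N ->
  (X a - X b) * F X k.+1 ((a, kb) :: q2 ++ (b, ka) :: q3) =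
  X a * F X k.+1 ((b, kb) :: q2 ++ (a, ka) :: q3)
  - X b * F Y k.+1 ((b, kb) :: q2 ++ (a, ka) :: q3).
Proof.
move=> sXY xy a2 a3; have [Ya Yb e] := sXY.
case: kb => [_|h hka] /=; first exact: h1.
rewrite !(sum_off (allowed a h.+1 _)) !(sum_off (allowed b h.+1 _)).
rewrite !allowed_occupied (off_sum_weight _ _ sXY).
have s23 : avoid (q2 ++ q3) by rewrite avoid_cat a2.
have red w v u : v != u -> allowed w h.+1 (q2 ++ (v, ka) :: q3) u =
    allowed w h.+1 (q2 ++ q3) u.
  by move=> vu; rewrite !allowed_cat allowed_cons eq_sym vu /= ltnNge hka.
have ab := adj_neq hab; have ba : b != a by rewrite eq_sym.
rewrite !red // (allowed_stay_a _ s23) (allowed_stay_b _ s23).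
have ePQ u : off u -> allowed a h.+1 (q2 ++ (b, ka) :: q3) u =
                      allowed b h.+1 (q2 ++ (a, ka) :: q3) u.
  move=> ou; have /andP[ua ub] := ou.
  by rewrite !red ?(allowed_from hab) // eq_sym.
rewrite (eq_off _ ePQ).
have LS : forall u, off u -> (X a - X b) * F X k (rcons (q2 ++ (b, ka) :: q3) (u, h)) =
   X a * F X k (rcons (q2 ++ (a, ka) :: q3) (u, h)) -
   X b * F Y k (rcons (q2 ++ (a, ka) :: q3) (u, h)).
  by move=> u ou; rewrite !rcons_slot (h1 ka sXY) //; exact: avoid_rcons.
have {}LS := lin_sum X (allowed b h.+1 (q2 ++ (a, ka) :: q3)) LS.
have [_ L] := hb sXY xy a2 a3 (isT : avoid [::]) hka.
rewrite !rcons_slot -!cats1 Yb /= in L *.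
by apply: (eq_of_sub (f_equal2 +%R LS (congr1 ( *%R (- X a)) L))); ring.
Qed.

Lemma small_first_step : small_first k.+1.
Proof.
move=> X Y [|[w h] q1] q2 q3 ka kb sXY xy; first by move=> _; exact: small_first_head.
rewrite avoid_cons => /andP[/= ow a1] a2 a3 kk; have [Ya Yb e] := sXY.
case: h => [|h]; first exact: hs.
rewrite !(sum_off (allowed w h.+1 _)) !allowed_occupied !allowed_occupied2.
rewrite (off_sum_weight _ _ sXY) (eq_off _ (fun u ou => allowed_third2 _ _ _ _ _ _ ow ou)).
rewrite !addr0; apply: lin_sum => u ou; rewrite !rcons_slot2.
by apply: (hs sXY) => //; exact: avoid_rcons.
Qed.

(** The particle at [b] may not pass the one just below it, which disappears earlier, so it stays.
    This yields [X b] times a function that is symmetric by [small_first]. *)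
Lemma big_first_head X Y q2 q3 ka kb : swapped X Y -> X a != X b ->
  avoid q2 -> avoid q3 -> (kb < ka)%N ->
  X a * F X k.+1 ((b, ka) :: q2 ++ (a, kb) :: q3) =
  X b * F Y k.+1 ((b, ka) :: q2 ++ (a, kb) :: q3) /\
  X b * (F X k.+1 ((a, ka) :: q2 ++ (b, kb) :: q3)
         - F Y k.+1 ((a, ka) :: q2 ++ (b, kb) :: q3)) =
  (X a - X b) * F X k.+1 ((b, ka) :: q2 ++ (a, kb) :: q3).
Proof.
move=> sXY xy a2 a3; have [Ya Yb e] := sXY; have ab := adj_neq hab.
have ba : b != a by rewrite eq_sym.
case: ka => // h; rewrite ltnS => hkb /=.
have s23 : avoid (q2 ++ q3) by rewrite avoid_cat a2.
rewrite !(sum_off (allowed a h.+1 _)) !(sum_off (allowed b h.+1 _)) !allowed_occupied.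
have nX (Z : 'I_n -> R) G :
    \sum_(u | allowed b h.+1 (q2 ++ (a, kb) :: q3) u && off u) Z u * G u = 0.
  rewrite big_pred0 // => u; case ou: (off u); rewrite ?andbF // andbT.
  have /andP[ua ub] := ou; rewrite allowed_cat allowed_cons /= ltnS hkb /=.
  rewrite (dist_from hab ab) dist_refl (dist_from hab ub) ltnS ltn0.
  by rewrite andbF /= andbF.
rewrite !nX.
have stay_a : allowed a h.+1 (q2 ++ (b, kb) :: q3) a.
  apply: allowed_stay; rewrite map_cat mem_cat /= inE negb_or negb_or ab /=.
  by have /andP[-> _] := avoid_notin a2; have /andP[-> _] := avoid_notin a3.
have stay_b : allowed b h.+1 (q2 ++ (a, kb) :: q3) b.
  apply: allowed_stay; rewrite map_cat mem_cat /= inE negb_or negb_or ba /=.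
  by have /andP[_ ->] := avoid_notin a2; have /andP[_ ->] := avoid_notin a3.
rewrite stay_a stay_b !rcons_slot.
rewrite (@off_F_sum X Y _ _ (fun u => F X k (rcons (q2 ++ (b, kb) :: q3) (u, h)))) //;
  last first.
  by move=> u ou; rewrite !rcons_slot (lone_sym _ h1 sXY) //; exact: avoid_rcons.
have L := hs sXY xy a2 a3 (isT : avoid [::]) hkb.
rewrite -!cats1 (small_first_sym hs sXY xy a2 a3 (isT : avoid [::]) hkb) Ya Yb.
split; first by ring.
by apply: (eq_of_sub (congr1 ( *%R (- X b)) L)); ring.
Qed.

Lemma big_first_step : big_first k.+1.
Proof.
move=> X Y [|[w h] q1] q2 q3 ka kb sXY xy; first by move=> _; exact: big_first_head.
rewrite avoid_cons => /andP[/= ow a1] a2 a3 kk; have [Ya Yb e] := sXY.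
case: h => [|h]; first exact: hb.
rewrite !(sum_off (allowed w h.+1 _)) !allowed_occupied !allowed_occupied2.
rewrite !(off_sum_weight _ _ sXY).
rewrite !addr0; split.
  rewrite !mulr_sumr; apply: eq_bigr => u /andP[_ ou].
  rewrite !rcons_slot2 !(mulrCA _ (X u)); congr (_ * _).
  by have [] := hb sXY xy a1 a2 (avoid_rcons h a3 ou) kk.
rewrite mulrBr 2!(eq_off _ (fun u ou => allowed_third2 _ _ _ _ _ _ ow ou)).
apply/esym; apply: lin_sum => u ou; rewrite !rcons_slot2 -mulrBr; apply/esym.
by have [] := hb sXY xy a1 a2 (avoid_rcons h a3 ou) kk.
Qed.

End Step.

Lemma demazure_relations k : [/\ sym0 k, lone k, small_first k & big_first k].
Proof.
elim: k => [|k [h0 h1 hs hb]].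
  by split; move=> *; rewrite /= ?subrr ?mulr0 ?subrr ?mulr0.
split; [exact: sym0_step|exact: lone_step|exact: small_first_step|exact: big_first_step].
Qed.

End Weights.

(** * From generating functions to individual runs *)

Section Paths.
Variable n : nat.
Local Open Scope ring_scope.
Implicit Types (q r : seq (particle n)) (l : seq 'I_n).

Inductive run : seq (particle n) -> seq 'I_n -> Prop :=
| run_nil : run [::] [::]
| run_die w r l : run r l -> run ((w, 0%N) :: r) l
| run_move w h r u l : allowed w h.+1 r u -> run (rcons r (u, h)) l ->
    run ((w, h.+1) :: r) (u :: l).

Fixpoint paths k q : seq (seq 'I_n) :=
  if k is k'.+1 then
    match q with
    | [::] => [:: [::]]
    | (w, 0%N) :: r => paths k' r
    | (w, h.+1) :: r =>
        flatten [seq [seq u :: l | l <- paths k' (rcons r (u, h))]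
                | u <- enum (allowed w h.+1 r)]
    end
  else [::].

Lemma pathsP q l : run q l <-> exists k, l \in paths k q.
Proof.
split.
  elim=> [|w r {}l _ [k IH]|w h r u {}l au _ [k IH]]; first by exists 1%N.
    by exists k.+1.
  exists k.+1; apply/flatten_mapP; exists u; first by rewrite mem_enum.
  exact: map_f.
case=> k; elim: k q l => // k IH [|[w [|h]] r] l /=.
- by rewrite inE => /eqP ->; exact: run_nil.
- by move=> /IH; exact: run_die.
case/flatten_mapP=> u; rewrite mem_enum => au /mapP[l' /IH hl' ->].
exact: run_move.
Qed.

Lemma F_paths (R : comNzRingType) (X : 'I_n -> R) k q :
  F X k q = \sum_(l <- paths k q) \prod_(u <- l) X u.
Proof.
elim: k q => [|k IH] [|[w [|h]] r] /=; rewrite ?big_nil //.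
  by rewrite big_seq1 big_nil.
rewrite big_flatten big_map big_enum /=; apply: eq_bigr => u _.
by rewrite IH big_map mulr_sumr; apply: eq_bigr => l _; rewrite big_cons.
Qed.

Definition content l : 'X_{1..n} := [multinom count_mem v l | v < n].

Lemma prod_content (f : 'I_n -> 'I_n) l :
  \prod_(u <- l) 'X_(f u) = 'X_[int, content (map f l)].
Proof.
elim: l => [|u l IH]; first by rewrite big_nil -mpolyX0; congr (mpolyX _ _); apply/mnmP=> v; rewrite !mnmE.
rewrite big_cons IH -mpolyXD; congr (mpolyX _ _); apply/mnmP=> v.
by rewrite mnmDE !mnmE.
Qed.

(** With variables as weights, coefficients count runs by content. Symmetry equates the counts for a
    content and its swap; [l] makes one of them positive, hence both. *)
Lemma run_sym (a b : 'I_n) m r l : b = a.+1 :> nat -> avoid_pair a b r ->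
  run ((b, m) :: r) l ->
  exists2 l', run ((b, m) :: r) l' &
    forall v, count_mem v l' = count_mem (tperm a b v) l.
Proof.
move=> hab ar /pathsP[k hk].
pose X v : {mpoly int[n]} := 'X_v; pose Y v : {mpoly int[n]} := 'X_(tperm a b v).
have sXY : swapped a b X Y.
  split; rewrite /X /Y ?tpermL ?tpermR // => u /andP[ua ub].
  by rewrite tpermD // eq_sym.
have xy : X a != X b.
  apply: contraTneq isT => /(congr1 (mcoeff U_(a))).
  by rewrite !mcoeffXU eqxx eq_sym (negbTE (adj_neq hab)) => /eqP.
have [_ L _ _] := demazure_relations {mpoly int[n]} hab k.
have := lone_sym (q1 := [::]) m L sXY xy isT ar.
rewrite /= !F_paths; pose f : 'I_n -> 'I_n := tperm a b.
under eq_bigr do rewrite (prod_content f).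
under [in RHS]eq_bigr do rewrite (prod_content id) map_id.
move=> /(congr1 (mcoeff (content (map f l)))); rewrite !raddf_sum /=.
under eq_bigr do rewrite mcoeffX.
under [in RHS]eq_bigr do rewrite mcoeffX.
rewrite (big_rem l hk) /= eqxx => e.
have : (\sum_(i <- paths k ((b, m) :: r)) (content i == content (map f l))%:R : int) != 0.
  rewrite -e; apply: lt0r_neq0; rewrite ltr_wpDr //.
  by apply: sumr_ge0 => i _; exact: ler0n.
case: (boolP (has (fun i => content i == content (map f l)) (paths k ((b, m) :: r)))).
  move=> /hasP[l' hl' /eqP c] _; exists l'; first by apply/pathsP; exists k.
  move=> v; move/mnmP/(_ v): c; rewrite !mnmE => ->.
  rewrite count_map; apply: eq_count => u /=.
  by rewrite -(inj_eq (@perm_inj _ (tperm a b))) tpermK.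
move=> /hasPn none; rewrite big_seq big1 ?eqxx // => i /none.
by move=> /negbTE ->.
Qed.
End Paths.

(** * Bruhat order on compositions *)

Section Dominance.
Variable n : nat.
Local Open Scope nat_scope.
Implicit Types (beta mu : 'I_n -> nat).

(* thr c i is the number of t < c with t = i mod n, so that excess c mu counts *)
(* the boxes of column i and row j >= 1 with n (j - 1) + i >= c.               *)
Definition thr c (i : 'I_n) : nat := c %/ n + (i < c %% n).

Definition excess c beta : nat := \sum_i (beta i - thr c i).

Definition dominated beta mu : Prop :=
  \sum_i beta i = \sum_i mu i /\ forall c, excess c beta <= excess c mu.

Lemma thrS c (i : 'I_n) : thr c.+1 i = thr c i + (i == c %% n :> nat).
Proof.
have hi := ltn_ord i; have n0 : 0 < n by apply: leq_ltn_trans hi.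
rewrite /thr divnS // modnS; have := ltn_pmod c n0.
case: ifP => [h|_]; last by move: (c %/ n) (c %% n) => k r hr; lia.
have : c %% n = n.-1.
  have : n %| (c %% n).+1.
    by move: h; rewrite {1}(divn_eq c n) -addnS dvdn_addr ?dvdn_mull.
  move=> /(dvdn_leq (ltn0Sn _)); have := ltn_pmod c n0.
  by move: (c %% n) => r; case: (n) n0 => // m _ /=; clear; lia.
by move=> ->; move: (c %/ n) => k _; clear -hi n0; lia.
Qed.

(** Only one cell carries the number [c], and it lies in column [c %% n]. *)
Lemma excessS c (i : 'I_n) beta : i = c %% n :> nat ->
  excess c beta = excess c.+1 beta + (thr c i < beta i).
Proof.
move=> hi; rewrite /excess (bigD1 i) //= [in RHS](bigD1 i) //= thrS hi eqxx.
rewrite [in RHS](eq_bigr (fun j => beta j - thr c j)).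
  by case: ltnP; lia.
move=> j; rewrite -val_eqE /= hi => ji; rewrite thrS.
by rewrite (negbTE ji) addn0.
Qed.

Section Swap.
Variables a b : 'I_n.
Hypothesis hab : b = a.+1 :> nat.
Local Notation s := (tperm a b).

Lemma excess_swap c beta : c %% n != b -> excess c (beta \o s) = excess c beta.
Proof.
move=> hc; rewrite /excess (reindex_inj (@perm_inj _ s)) /=; apply: eq_bigr => i _.
rewrite tpermK; congr (_ - _); rewrite /thr; congr (_ + nat_of_bool _).
by case: tpermP => [->|->|//]; lia.
Qed.

Lemma excess_at c : c.+1 %% n = b ->
  [/\ c %% n = a, thr c a = c.+1 %/ n, thr c.+1 b = c.+1 %/ n & c.+2 %% n != b].
Proof.
have n0 : 0 < n by apply: leq_ltn_trans (ltn_ord b).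
have n1 : n != 1 by have := ltn_ord b; rewrite hab; lia.
move=> hc; have := hc; rewrite modnS; case: ifP => [_|h]; first by rewrite hab.
rewrite hab => -[ca]; rewrite /thr ca hc !ltnn !addn0 divnS // h; split=> //.
rewrite modnS hc hab; case: ifP => _ //.
by rewrite neq_ltn ltnSn orbT.
Qed.

(** The swap is visible only at an index [c.+1] congruent to [b]. If [beta] has the cell of column
    [a] numbered [c], the inequality at [c] suffices. Otherwise [beta b <= beta a] shows that [beta]
    loses nothing from [c] to [c.+2], and the inequality at [c.+2] applies. *)
Lemma dominated_swap_upper beta mu : dominated beta mu -> mu a = 0 ->
  beta b <= beta a -> dominated beta (mu \o s).
Proof.
move=> [h1 h2] m0 hb; split.
  by rewrite h1 (reindex_inj (@perm_inj _ s)).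
move=> c; case: (eqVneq (c %% n) b) => hc; last by rewrite (excess_swap _ hc).
case: c hc => [|c] hc; first by move: hc; rewrite mod0n; lia.
have [ca ta tb c2] := excess_at hc; have := h2 c; have := h2 c.+2.
have na : c %% n != b by rewrite ca hab; lia.
have e1 := excessS (i := a) (mu \o s) (esym ca).
have e2 := excessS (i := a) beta (esym ca).
have e3 := excessS (i := b) beta (esym hc).
have e4 := excessS (i := a) mu (esym ca).
have e5 := excessS (i := b) mu (esym hc).
rewrite (excess_swap _ na) /= tpermL in e1.
rewrite ta ?m0 in e1 e2 e4; rewrite tb in e3 e5.
move: e1 e2 e3 e4 e5 hb; rewrite ltn0; move: (c.+1 %/ n) (beta a) (beta b) (mu b).
move: (excess _ _) (excess _ _) (excess _ _) (excess _ _) (excess _ _) (excess _ _) (excess _ _).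
clear; move=> *; lia.
Qed.

(** At an index just past a cell of column [a], putting the larger entry into that column can only
    lower the excess; the other indices do not see the swap. *)
Lemma dominated_swap_lower beta mu : dominated beta mu ->
  beta a <= beta b -> dominated (beta \o s) mu.
Proof.
move=> [h1 h2] hb; split.
  by rewrite -h1 [RHS](reindex_inj (@perm_inj _ s)).
move=> c; case: (eqVneq (c %% n) b) => hc; last by rewrite (excess_swap _ hc).
case: c hc => [|c] hc; first by move: hc; rewrite mod0n; lia.
have [ca ta tb c2] := excess_at hc; have := h2 c.+1.
have na : c %% n != b by rewrite ca hab; lia.
have e1 := excessS (i := a) (beta \o s) (esym ca).
have e2 := excessS (i := a) beta (esym ca).
rewrite (excess_swap _ na) /= tpermL in e1.
rewrite ta in e1 e2; move: e1 e2 hb; move: (c.+1 %/ n) (beta a) (beta b).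
move: (excess _ _) (excess _ _) (excess _ _) (excess _ _).
clear; move=> *; lia.
Qed.
End Swap.
End Dominance.

(** * Rotation of the cycle *)

Section Reach.
Local Open Scope nat_scope.

Definition queue n (mu : 'I_n -> nat) : seq (particle n) :=
  [seq (i, mu i) | i <- enum 'I_n].

Definition reaches n (q : seq (particle n)) (beta : 'I_n -> nat) : Prop :=
  exists2 l, run q l & forall v, count_mem v l = beta v.

Section Rotation.
Variable n : nat.
Implicit Types (beta mu : 'I_n.+1 -> nat).

Lemma dist_ordS (w v : 'I_n.+1) : dist (ordS w) (ordS v) = dist w v.
Proof.
have e (i : 'I_n.+1) : ordS i = (if i == n :> nat then 0 else i.+1) :> nat.
  have := ltn_ord i; rewrite ltnS leq_eqVlt /=; case: eqP => [->|_] /= hi.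
    by rewrite modnn.
  by rewrite modn_small.
rewrite !distE !e; have := ltn_ord w; have := ltn_ord v.
by do 2![case: eqP => ?]; rewrite ?ltnS ?leq0n ?ltn0; do ?case: ifP => ?; lia.
Qed.

Definition rotp (p : particle n.+1) : particle n.+1 := (ordS p.1, p.2).

Lemma allowed_ordS w h (q : seq (particle n.+1)) u :
  allowed (ordS w) h (map rotp q) (ordS u) = allowed w h q u.
Proof.
elim: q => // p q IH; rewrite map_cons !allowed_cons IH /= !dist_ordS.
by rewrite (inj_eq (@ordS_inj _)).
Qed.

Lemma run_ordS (q : seq (particle n.+1)) l :
  run q l -> run (map rotp q) (map (@ordS n.+1) l).
Proof.
elim=> [|w r {}l _ IH|w h r u {}l au _ IH] /=; first exact: run_nil.
  exact: run_die.
by rewrite map_rcons in IH; apply: run_move; rewrite ?allowed_ordS.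
Qed.

(* The composition left once column 0 has used its first box, sites being      *)
(* renumbered by - 1 mod n.                                                    *)
Definition unrot mu (i : 'I_n.+1) : nat := mu (ordS i) - (ordS i == ord0).

Lemma queue_unrot mu :
  map rotp (queue (unrot mu)) =
  rcons [seq (lift ord0 i, mu (lift ord0 i)) | i <- enum 'I_n] (ord0, (mu ord0).-1).
Proof.
have emax : ordS (@ord_max n) = ord0 by apply: val_inj; rewrite /= modnn.
rewrite /queue enum_ordSr !map_rcons -!map_comp /rotp /unrot /= emax eqxx subn1.
congr rcons; apply: eq_map => i /=.
have -> : ordS (widen_ord (leqnSn n) i) = lift ord0 i.
  by apply: val_inj; rewrite /= modn_small ?ltnS.
by rewrite subn0.
Qed.

Lemma excess_unrot c mu : excess c (unrot mu) = excess c.+1 mu.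
Proof.
rewrite /excess [RHS](reindex_inj (@ordS_inj _)) /=; apply: eq_bigr => i _.
rewrite /unrot -subnDA; congr (_ - _).
suff : thr c.+1 (ordS i) = thr c i + (ordS i == ord0) by rewrite addnC => ->.
rewrite /thr divnS // [c.+1 %% _]modnS -val_eqE /=.
have hi : i.+1 %% n.+1 = if i == n :> nat then 0 else i.+1.
  have := ltn_ord i; rewrite ltnS leq_eqVlt /=; case: eqP => [->|_] /= h.
    by rewrite modnn.
  by rewrite modn_small.
have hm := ltn_pmod c (ltn0Sn n).
rewrite hi; case h : (n.+1 %| c.+1); last first.
  have := ltn_ord i; case: eqP => [->|ne]; move: (c %/ _) hm => k; move: (c %% _) => r; lia.
have -> : c %% n.+1 = n.
  have : n.+1 %| (c %% n.+1).+1.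
    by move: h; rewrite {1}(divn_eq c n.+1) -addnS dvdn_addr ?dvdn_mull.
  by move=> /(dvdn_leq (ltn0Sn _)); move: hm; move: (c %% _) => r; lia.
have := ltn_ord i; case: eqP => [->|ne]; move: (c %/ _) => k; lia.
Qed.

Lemma thr0 (i : 'I_n.+1) : thr 0 i = 0.
Proof. by rewrite /thr div0n mod0n. Qed.

Lemma excess0 beta : excess 0 beta = \sum_i beta i.
Proof. rewrite /excess; apply: eq_bigr => i _; by rewrite thr0 subn0. Qed.

Lemma excess1_lt mu : 0 < mu ord0 -> (excess 1 mu).+1 = \sum_i mu i.
Proof.
move=> m0; rewrite -excess0 [RHS](excessS (i := ord0)) ?mod0n //.
by rewrite thr0 m0 addn1.
Qed.

(** Otherwise [beta] loses nothing from index 0 to index 1 while [mu] loses one, although the totals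
    agree. *)
Lemma dominated_head beta mu : dominated beta mu -> 0 < mu ord0 -> 0 < beta ord0.
Proof.
move=> [h1 h2] m0; rewrite lt0n; apply/eqP => b0.
have : excess 1 beta = \sum_i beta i.
  by rewrite -excess0 [RHS](excessS (i := ord0)) ?mod0n // b0 ltn0 addn0.
by have := h2 1; have := excess1_lt m0; lia.
Qed.

Lemma sum_unrot mu : 0 < mu ord0 -> (\sum_i unrot mu i).+1 = \sum_i mu i.
Proof.
by move=> m0; rewrite -(excess1_lt m0) -excess_unrot excess0.
Qed.

Lemma dominated_unrot beta mu : dominated beta mu -> 0 < mu ord0 ->
  dominated (unrot beta) (unrot mu).
Proof.
move=> d m0; have b0 := dominated_head d m0; have [h1 h2] := d; split.
  by apply: succn_inj; rewrite !sum_unrot.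
by move=> c; rewrite !excess_unrot.
Qed.

Lemma reaches_unrot beta mu : 0 < mu ord0 -> 0 < beta ord0 ->
  reaches (queue (unrot mu)) (unrot beta) -> reaches (queue mu) beta.
Proof.
move=> m0 b0 [l hl cl]; exists (ord0 :: map (@ordS n.+1) l); last first.
  move=> v /=; rewrite count_map -[v in RHS](ord_predK v).
  have -> : count (preim (@ordS n.+1) (pred1 v)) l = unrot beta (ord_pred v).
    rewrite -cl; apply: eq_count => u /=.
    by rewrite -{1}(ord_predK v) (inj_eq (@ordS_inj _)).
  rewrite /unrot ord_predK (eq_sym ord0); case: eqP => [->|_]; last by rewrite subn0.
  by rewrite subnKC.
rewrite /queue enum_ordSl /= -(prednK m0) -map_comp; apply: run_move.
  apply: allowed_stay; apply/mapP => -[p /mapP[i _ ->] /= e].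
  by move: (neq_lift ord0 i) => /eqP; apply.
by have := run_ordS hl; rewrite queue_unrot.
Qed.
End Rotation.

End Reach.

(** * Every dominated composition is a content *)

Section Existence.
Local Open Scope nat_scope.
Variable n : nat.
Implicit Types (beta mu : 'I_n -> nat).

Lemma run_zeros mu (s : seq 'I_n) r l : (forall i, i \in s -> mu i = 0) ->
  run ([seq (i, mu i) | i <- s] ++ r) l <-> run r l.
Proof.
elim: s => //= i s IH hz; rewrite hz ?mem_head //.
have {}IH : run ([seq (i, mu i) | i <- s] ++ r) l <-> run r l.
  by apply: IH => j js; rewrite hz // in_cons js orbT.
split; last by move=> h; apply: run_die; apply/IH.
by move=> h; inversion h; subst; apply/IH.
Qed.

Section Swap.
Variables a b : 'I_n.
Hypothesis hab : b = a.+1 :> nat.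

Lemma enum_split : exists A B, [/\ enum 'I_n = A ++ a :: b :: B,
  forall i, i \in A -> i < a & forall i, i \in B -> off_pair a b i].
Proof.
have ha : a < size (enum 'I_n) by rewrite size_enum_ord.
have hb : a.+1 < size (enum 'I_n) by rewrite size_enum_ord -hab.
exists (take a (enum 'I_n)), (drop a.+2 (enum 'I_n)).
have e : enum 'I_n = take a (enum 'I_n) ++ a :: b :: drop a.+2 (enum 'I_n).
  rewrite -[LHS](cat_take_drop a) (drop_nth a ha) (drop_nth a hb).
  by rewrite nth_ord_enum -[in nth _ _ _]hab nth_ord_enum.
split=> // i hi.
  by have := index_ltn hi; rewrite index_enum_ord.
have := enum_uniq 'I_n; rewrite e cat_uniq => /and3P[_ _ /= /and3P[]].
rewrite inE negb_or => /andP[_ na] nb _; rewrite /off_pair.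
by apply/andP; split; apply: contraTneq hi => ->.
Qed.

(** The same landings work. A first move from [a] while [b] is still occupied can also be made from
    [b] once [a] is empty, and afterwards the queues coincide. *)
Lemma reaches_swap_lower beta mu : (forall i : 'I_n, i < b -> mu i = 0) ->
  reaches (queue (mu \o tperm a b)) beta -> reaches (queue mu) beta.
Proof.
have [A [B [eE hA hB]]] := enum_split; move=> mz [l hl cl]; exists l => //.
have avA (i : 'I_n) : i \in A -> off_pair a b i.
  by move=> /hA ia; rewrite /off_pair -!val_eqE /= hab; lia.
have avT (i : 'I_n) : off_pair a b i -> (mu \o tperm a b) i = mu i.
  by move=> /andP[ia ib]; rewrite /= tpermD // eq_sym.
have avB : avoid_pair a b [seq (i, mu i) | i <- B].
  by apply/allP => p /mapP[i /hB oi ->].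
move: hl; rewrite /queue eE !map_cat /= tpermL tpermR.
have zA i : i \in A -> mu i = 0 by move=> /hA ia; apply: mz; rewrite hab; lia.
have -> : [seq (i, mu (tperm a b i)) | i <- A] = [seq (i, mu i) | i <- A].
  by apply/eq_in_map => i /avA/avT /= ->.
have -> : [seq (i, mu (tperm a b i)) | i <- B] = [seq (i, mu i) | i <- B].
  by apply/eq_in_map => i /hB/avT /= ->.
move=> /(run_zeros _ _ zA) hl; apply/(run_zeros _ _ zA).
have ma : mu a = 0 by apply: mz; rewrite hab.
rewrite ma in hl *; apply: run_die.
case eb : (mu b) hl => [|h] hl.
  by inversion hl; subst.
inversion hl as [| |w h' r u l' au hr]; subst; clear hl.
inversion hr; subst.
apply: run_move => //.
move: au; rewrite allowed_cons /= => /and3P[ub _ au].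
have [ua|ua] := eqVneq u a; first by rewrite ua; exact: (allowed_down hab).
have ou : off_pair a b u by rewrite /off_pair ua.
by rewrite -(allowed_from hab _ avB ou).
Qed.

Lemma reaches_swap_sym beta mu : (forall i : 'I_n, i < b -> mu i = 0) ->
  reaches (queue mu) (beta \o tperm a b) -> reaches (queue mu) beta.
Proof.
have [A [B [eE hA hB]]] := enum_split; move=> mz [l hl cl].
have avB : avoid_pair a b [seq (i, mu i) | i <- B].
  by apply/allP => p /mapP[i /hB oi ->].
have zA i : i \in A -> mu i = 0 by move=> /hA ia; apply: mz; rewrite hab; lia.
have ma : mu a = 0 by apply: mz; rewrite hab.
move: hl; rewrite /reaches /queue eE !map_cat /= ma.
move=> /(run_zeros _ _ zA) hl; inversion hl as [|w r l0 hl'|]; subst; clear hl.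
have [l' hr' cl'] := run_sym hab avB hl'.
exists l'; first by apply/(run_zeros _ _ zA); exact: run_die.
by move=> v; rewrite cl' cl /= tpermK.
Qed.
End Swap.
End Existence.

(** Induction on the number of boxes, then on the first nonempty column: rotating uses up a box, and
    swapping with the empty column on the left moves that column closer to 0. *)
Lemma dominated_reaches n (beta mu : 'I_n -> nat) :
  dominated beta mu -> reaches (queue mu) beta.
Proof.
case: n beta mu => [|n] beta mu.
  move=> _; exists [::] => [|[]//].
  by rewrite /queue (size0nil (size_enum_ord 0)); exact: run_nil.
move: {2}(\sum_i mu i)%N (erefl (\sum_i mu i)%N) => N.
elim: N beta mu => [|N IH] beta mu hN hd.
  have m0 i : mu i = 0%N.
    by apply/eqP; move/eqP: hN; rewrite sum_nat_eq0 => /forallP/(_ i).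
  have b0 i : beta i = 0%N.
    by have [/eqP + _] := hd; rewrite hN sum_nat_eq0 => /forallP/(_ i)/eqP.
  exists [::]; last by move=> v; rewrite b0.
  by rewrite /queue -[map _ _]cats0; apply/run_zeros => //; exact: run_nil.
have [p mp] : exists p, (0 < mu p)%N.
  apply/existsP; apply: contra_eqT hN => /existsPn h; rewrite big1 // => i _.
  by apply/eqP; move: (h i); rewrite -eqn0Ngt.
have [q qp hq] : exists2 q : 'I_n.+1, (0 < mu q)%N & forall i : 'I_n.+1, (i < q)%N -> mu i = 0%N.
  have [q hq hm] := @arg_minnP _ p (fun i => 0 < mu i)%N (fun i : 'I_n.+1 => nat_of_ord i) mp.
  exists q => // i iq; apply/eqP; rewrite -leqn0 leqNgt; apply/negP => /hm.
  by rewrite leqNgt iq.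
move: {2}(nat_of_ord q) (erefl (nat_of_ord q)) => k.
elim: k q beta mu hN hd {p mp} qp hq => [|k IHk] q beta mu hN hd qp hq hk.
  have q0 : q = ord0 by apply: val_inj.
  rewrite q0 in qp; have b0 := dominated_head hd qp.
  apply: reaches_unrot => //; apply: IH; last exact: dominated_unrot.
  by apply: succn_inj; rewrite sum_unrot.
have ka : (k < n.+1)%N by have := ltn_ord q; rewrite hk; lia.
pose a := Ordinal ka; have hab : q = a.+1 :> nat by rewrite hk.
have ma : mu a = 0%N by apply: hq; rewrite hk.
have lower beta' : dominated beta' mu -> (beta' q <= beta' a)%N -> reaches (queue mu) beta'.
  move=> hd' hb; apply: (reaches_swap_lower hab) => //.
  apply: (IHk a) => //.
  - by rewrite -hN [RHS](reindex_inj (@perm_inj _ (tperm a q))).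
  - exact: dominated_swap_upper.
  - by rewrite /= tpermL.
  move=> i ia; rewrite /= tpermD; first by apply: hq; rewrite hk ltnW.
    by rewrite -val_eqE /=; move: ia => /=; lia.
  by rewrite -val_eqE /= hk; move: ia => /=; lia.
have [hb|hb] := leqP (beta q) (beta a); first exact: lower.
apply: (reaches_swap_sym hab) => //; apply: lower.
  by apply: dominated_swap_lower => //; exact: ltnW.
by rewrite /= tpermL tpermR ltnW.
Qed.

(** * Fillings *)

Section Coinversions.
Local Open Scope nat_scope.
Variables (n : nat) (mu : 'I_n -> nat).
Local Notation row := Defs.row.
Local Notation col := Defs.col.
Local Notation abox := (abox mu).
Local Notation box := (box mu).
Implicit Types (u : box) (x y v : abox) (sigma : filling mu).

Lemma sum_box (F : abox -> nat) :
  \sum_(x | 0 < row x) F x = \sum_(u : box) F (val u).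
Proof.
rewrite (@reindex_omap _ _ _ _ {x : abox | 0 < row x} val insub) /=.
  by apply: eq_bigl => u; rewrite valK eqxx (valP u).
by move=> x hx; rewrite insubT.
Qed.

Lemma abox_eq x y : col x = col y -> row x = row y -> x = y.
Proof.
case: x y => i j [i' j']; rewrite /col /row /= => e; case: _ / e j' => j' e.
by congr Tagged; apply: val_inj.
Qed.

Definition lift_box (i : 'I_n) (j : nat) : abox :=
  Tagged (fun i => 'I_(mu i).+1) (inord j : 'I_(mu i).+1).

Lemma col_lift i j : col (lift_box i j) = i. Proof. by []. Qed.

Lemma row_lift i j : j <= mu i -> row (lift_box i j) = j.
Proof. by move=> h; rewrite /row /= inordK. Qed.

Lemma row_le x : row x <= mu (col x).
Proof. by rewrite /row -ltnS; case: x => i j /=. Qed.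

Lemma row_below u : (row (below u)).+1 = row (val u).
Proof.
have h := row_le (val u); have u0 := valP u.
rewrite /below -/(lift_box _ _) row_lift ?prednK //.
by apply: leq_trans h; exact: leq_pred.
Qed.

Lemma col_below u : col (below u) = col (val u). Proof. by []. Qed.

Lemma sum_below (F : abox -> nat) :
  \sum_(x | row x < mu (col x)) F x = \sum_(u : box) F (below u).
Proof.
pose above x : option box := insub (lift_box (col x) (row x).+1).
rewrite (reindex_omap (@below n mu) above).
  apply: eq_bigl => u; rewrite col_below row_below row_le /above row_below /=.
  rewrite (_ : lift_box _ _ = val u) ?valK ?eqxx //.
  by apply: abox_eq; rewrite ?row_lift ?row_le.
move=> x hx; have r : row (lift_box (col x) (row x).+1) = (row x).+1 by rewrite row_lift.
rewrite /above insubT ?r // => p /=; congr Some; apply: abox_eq; rewrite ?col_below //=.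
by apply: succn_inj; rewrite row_below /= r.
Qed.

Lemma sum_base (F : abox -> nat) :
  \sum_(x | row x == 0) F x = \sum_i F (lift_box i 0).
Proof.
rewrite (reindex_onto (lift_box^~ 0) (@Defs.col n mu)).
  by apply: eq_bigl => i; rewrite row_lift // col_lift !eqxx.
by move=> x /eqP hx; apply: abox_eq; rewrite ?row_lift ?hx.
Qed.

Lemma sum_restrict (I : finType) (P : pred I) (F : I -> nat) :
  (forall i, ~~ P i -> F i = 0) -> \sum_i F i = \sum_(i | P i) F i.
Proof. by move=> h; rewrite (bigID P) /= [X in _ + X]big1 ?addn0. Qed.

Definition same_row_arm u v :=
  [&& row v == row (val u), col v < col (val u) & mu (col v) <= mu (col (val u))].

Definition lower_row_arm u v :=
  [&& (row v).+1 == row (val u), col (val u) < col v & mu (col v) < mu (col (val u))].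

Lemma armE u : arm u = \sum_v (same_row_arm u v + lower_row_arm u v).
Proof.
rewrite /arm -!sum1dep_card big_split /=; congr (_ + _); last first.
  by rewrite big_mkcond; apply: eq_bigr => v _; rewrite /lower_row_arm; case: ifP.
rewrite big_mkcond -(sum_box (fun v => if same_row_arm u v then 1 else 0)) /=.
rewrite big_mkcond /=; apply: eq_bigr => v _; case: ifP => [_|h]; first by case: ifP.
rewrite /same_row_arm; case: eqP => //= e.
by rewrite e (valP u : 0 < row (val u)) in h.
Qed.

Definition chi sigma x y : nat := augment sigma y < augment sigma x.

Lemma card_Inv sigma :
  #|Inv sigma| = \sum_x \sum_y
    (attack x y && reads_before x y) * chi sigma x y.
Proof.
rewrite -sum1dep_card big_mkcond pair_big /=; apply: eq_bigr => p _.
by rewrite /chi; case: attack; case: reads_before; case: (_ < _).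
Qed.

Lemma augment_base sigma i : augment sigma (lift_box i 0) = i.
Proof. by rewrite /augment insubF // row_lift. Qed.

(** An attacking pair in reading order either is in [P0], and these cancel the constant in [inv], or
    contains the arm box [v] of exactly one triple [u], [v], [below u]. So [coinv] is a sum over
    triples, and [good] makes each term vanish. *)
Lemma coinv_eq0 sigma :
  (forall u v, same_row_arm u v || lower_row_arm u v ->
     chi sigma (val u) v + chi sigma v (below u) = 1 + chi sigma (val u) (below u)) ->
  coinv sigma = 0.
Proof.
move=> good.
(* [P1] and [P4] give the pairs of [u] and [v], for [v] in the row of [u] or below it; [P3] and [P2]
   give the respective pairs of [v] and [below u]. *)
pose P0 x y := [&& row x == 0, row y == 0, col y < col x & mu (col y) <= mu (col x)].
pose P1 x y := [&& 0 < row x, row x == row y, col y < col x & mu (col y) <= mu (col x)].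
pose P2 x y := [&& row x == row y, col y < col x & mu (col x) < mu (col y)].
pose P3 x y := [&& row x == (row y).+1, col x < col y & mu (col x) <= mu (col y)].
pose P4 x y := [&& row x == (row y).+1, col x < col y & mu (col y) < mu (col x)].
have split5 x y : (attack x y && reads_before x y : nat) =
    P0 x y + P1 x y + P2 x y + P3 x y + P4 x y.
  rewrite /attack /reads_before /P0 /P1 /P2 /P3 /P4.
  case: (eqVneq x y) => [->|ne] /=; first by rewrite !ltnn !andbF.
  move: (row x) (row y) (col x : nat) (col y : nat) (mu (col x)) (mu (col y)).
  clear => r r' c c' m m'; lia.
have EI : #|Inv sigma| = \sum_x \sum_y P0 x y * chi sigma x y
   + \sum_x \sum_y P1 x y * chi sigma x y + \sum_x \sum_y P2 x y * chi sigma x y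
   + \sum_x \sum_y P3 x y * chi sigma x y + \sum_x \sum_y P4 x y * chi sigma x y.
  rewrite card_Inv -!big_split; apply: eq_bigr => x _.
  by rewrite -!big_split; apply: eq_bigr => y _; rewrite split5 !mulnDl.
have E0 : \sum_x \sum_y P0 x y * chi sigma x y =
    #|[set p : 'I_n * 'I_n | (p.1 < p.2) && (mu p.1 <= mu p.2)]|.
  rewrite (sum_restrict (P := fun x => row x == 0)); last first.
    by move=> x hx; apply: big1 => y _; rewrite /P0 (negbTE hx).
  rewrite sum_base; transitivity (\sum_(i : 'I_n) \sum_(j : 'I_n) ((j < i) && (mu j <= mu i) : nat)).
    apply: eq_bigr => i _.
    rewrite (sum_restrict (P := fun x => row x == 0)); last first.
      by move=> x hx; rewrite /P0 (negbTE hx) andbF.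
    rewrite sum_base; apply: eq_bigr => j _.
    rewrite /P0 !row_lift // !col_lift /chi !augment_base /=.
    by case: (_ < _); rewrite ?muln0 ?muln1.
  rewrite exchange_big pair_big /= -sum1dep_card [RHS]big_mkcond.
  by apply: eq_bigr => p _; case: ifP.
have E1 : \sum_x \sum_y P1 x y * chi sigma x y =
    \sum_u \sum_v same_row_arm u v * chi sigma (val u) v.
  rewrite (sum_restrict (P := fun x => 0 < row x)); last first.
    by move=> x hx; apply: big1 => y _; rewrite /P1 (negbTE hx).
  rewrite sum_box; apply: eq_bigr => u _; apply: eq_bigr => v _.
  by rewrite /P1 (valP u) /same_row_arm (eq_sym (row v)).
have E4 : \sum_x \sum_y P4 x y * chi sigma x y =
    \sum_u \sum_v lower_row_arm u v * chi sigma (val u) v.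
  rewrite (sum_restrict (P := fun x => 0 < row x)); last first.
    move=> x hx; apply: big1 => y _; rewrite /P4; case: eqP => // e.
    by rewrite e in hx.
  rewrite sum_box; apply: eq_bigr => u _; apply: eq_bigr => v _.
  by rewrite /P4 /lower_row_arm (eq_sym (row v).+1).
have E3 : \sum_x \sum_y P3 x y * chi sigma x y =
    \sum_u \sum_v same_row_arm u v * chi sigma v (below u).
  rewrite exchange_big (sum_restrict (P := fun x => row x < mu (col x))); last first.
    move=> y hy; apply: big1 => x _; rewrite /P3; case: and3P => // -[/eqP e _ h].
    by move: hy; rewrite -leqNgt -ltnS -e ltnNge (leq_trans (row_le x)).
  rewrite sum_below; apply: eq_bigr => u _; apply: eq_bigr => v _.
  by rewrite /P3 row_below col_below.
have E2 : \sum_x \sum_y P2 x y * chi sigma x y =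
    \sum_u \sum_v lower_row_arm u v * chi sigma v (below u).
  rewrite exchange_big (sum_restrict (P := fun x => row x < mu (col x))); last first.
    move=> y hy; apply: big1 => x _; rewrite /P2; case: and3P => // -[/eqP e _ h].
    by move: hy; rewrite -e (leq_ltn_trans (row_le x)).
  rewrite sum_below; apply: eq_bigr => u _; apply: eq_bigr => v _.
  by rewrite /P2 /lower_row_arm -(eqn_add2r 1) !addn1 row_below col_below.
have ED : \sum_(u : box) arm u + \sum_(u in Des sigma) arm u =
    \sum_u \sum_v (same_row_arm u v + lower_row_arm u v) * (1 + chi sigma (val u) (below u)).
  rewrite (big_mkcond (fun u => u \in Des sigma)).
  rewrite -big_split; apply: eq_bigr => u _ /=.
  rewrite -big_distrl /= -armE mulnDr muln1 inE /chi; congr (_ + _).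
  by case: ifP; rewrite ?muln1 ?muln0.
have EG : \sum_u \sum_v (same_row_arm u v + lower_row_arm u v) * (1 + chi sigma (val u) (below u))
   = \sum_u \sum_v (same_row_arm u v + lower_row_arm u v) * (chi sigma (val u) v + chi sigma v (below u)).
  apply: eq_bigr => u _; apply: eq_bigr => v _.
  case: (boolP (same_row_arm u v || lower_row_arm u v)) => [/good -> //|].
  by rewrite negb_or => /andP[/negbTE -> /negbTE ->].
have EI' : #|Inv sigma| = #|[set p : 'I_n * 'I_n | (p.1 < p.2) && (mu p.1 <= mu p.2)]|
    + (\sum_(u : box) arm u + \sum_(u in Des sigma) arm u).
  rewrite EI E0 ED EG -!addnA; congr (_ + _); rewrite E1 E2 E3 E4 -!big_split.
  apply: eq_bigr => u _; rewrite -!big_split; apply: eq_bigr => v _ /=.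
  by rewrite !mulnDl !mulnDr; lia.
rewrite /coinv /Defs.inv EI' -!(big_morph Posz PoszD (erefl (Posz 0))).
move: #|_| (\sum_u _) (\sum_(u in _) _); clear => x y z; lia.
Qed.
End Coinversions.

(** * Runs as sequences indexed by time *)

Section Trace.
Local Open Scope nat_scope.
Variables (n : nat) (mu : 'I_n.+1 -> nat).
Local Notation row := Defs.row.
Local Notation col := Defs.col.
Implicit Types (G : nat -> 'I_n.+1) (s t : nat).

(* Time t = n j + i is when column i takes its entry G t in row j; the rows 0  *)
(* (the basement) are the times t < n.                                         *)
Definition tcol t : 'I_n.+1 := inord (t %% n.+1).

Definition alive t : bool := t %/ n.+1 <= mu (tcol t).

Definition remaining t : nat := mu (tcol t) - t %/ n.+1.

(** For [k = n.+1], the queue just before the particle that acted at time [s] acts again. Exhausted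
    columns are filtered out but keep their times. *)
Definition window G s k : seq (particle n.+1) :=
  [seq (G t, remaining t) | t <- iota s k & alive t].

Definition valid_move G s : bool :=
  allowed (G s) (remaining s) (window G s.+1 n) (G (s + n.+1)).

Lemma tcol_shift s : tcol (s + n.+1) = tcol s.
Proof. by rewrite /tcol modnDr. Qed.

Lemma div_shift s : (s + n.+1) %/ n.+1 = (s %/ n.+1).+1.
Proof. by rewrite divnDr // divnn addn1. Qed.

Lemma alive_shift s : alive (s + n.+1) = alive s && (0 < remaining s).
Proof. by rewrite /alive /remaining tcol_shift div_shift; lia. Qed.

Lemma remaining_shift s : remaining (s + n.+1) = (remaining s).-1.
Proof. by rewrite /remaining tcol_shift div_shift; lia. Qed.

Lemma eq_window G G' s k : (forall t, t < s + k -> G t = G' t) ->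
  window G s k = window G' s k.
Proof.
move=> e; apply/eq_in_map => t; rewrite mem_filter mem_iota => /andP[_ /andP[_ h]].
by rewrite e.
Qed.

Lemma window_head G s : window G s n.+1 =
  if alive s then (G s, remaining s) :: window G s.+1 n else window G s.+1 n.
Proof. by rewrite /window /=; case: ifP. Qed.

Lemma window_last G s : window G s.+1 n.+1 =
  if alive (s + n.+1) then rcons (window G s.+1 n) (G (s + n.+1), remaining (s + n.+1))
  else window G s.+1 n.
Proof.
have -> : window G s.+1 n.+1 = [seq (G t, remaining t) | t <- iota s.+1 n ++ [:: s + n.+1] & alive t].
  by rewrite /window -addSnnS -(iotaD s.+1 n 1) addn1.
rewrite filter_cat map_cat /= /window.
by case: ifP => _ /=; rewrite ?cats1 ?cats0.
Qed.

(** Induction on the time [k] left. An exhausted column consumes time but no landing; a move fixes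
    the value of [G] at [s + n.+1]. *)
Lemma run_trace k s G l : run (window G s n.+1) l ->
  (forall t, s + k <= t -> ~~ alive t) ->
  exists G', [/\ forall t, t < s + n.+1 -> G' t = G t,
    forall t, s <= t -> alive (t + n.+1) -> valid_move G' t &
    forall v, count_mem v l = count (fun t => alive t && (G' t == v)) (iota (s + n.+1) k)].
Proof.
elim: k s G l => [|k IH] s G l hr hd.
  exists G; split=> // [t st|v]; rewrite ?alive_shift ?(negbTE (hd _ _)) ?addn0 //.
  have w0 : window G s n.+1 = [::].
    rewrite /window (eq_in_filter (a2 := pred0)) ?filter_pred0 // => t.
    by rewrite mem_iota => /andP[st _]; apply: negbTE; apply: hd; rewrite addn0.
  by rewrite w0 in hr; inversion hr; subst.
have hd' t : s.+1 + k <= t -> ~~ alive t by rewrite addSnnS; exact: hd.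
have skip : run (window G s.+1 n) l -> ~~ alive (s + n.+1) ->
  exists G', [/\ forall t, t < s + n.+1 -> G' t = G t,
    forall t, s <= t -> alive (t + n.+1) -> valid_move G' t &
    forall v, count_mem v l = count (fun t => alive t && (G' t == v)) (iota (s + n.+1) k.+1)].
  move=> hr1 ha; have := window_last G s; rewrite (negbTE ha) => w.
  rewrite -w in hr1; have [G' [h1 h2 h3]] := IH _ _ _ hr1 hd'; exists G'; split.
  - by move=> t ht; apply: h1; rewrite addSn ltnW.
  - by move=> t; rewrite leq_eqVlt => /orP[/eqP <-|]; [rewrite (negbTE ha)|exact: h2].
  - by move=> v; rewrite h3 /= (negbTE ha).
move: hr; rewrite window_head; case: ifP => as_ hr; last first.
  by apply: skip => //; rewrite alive_shift as_.
case hl : (remaining s) hr => [|h] hr.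
  inversion hr as [|w r l0 hr'|]; subst; apply: skip => //.
  by rewrite alive_shift hl andbF.
inversion hr as [| |w h' r u l' au hr']; subst; clear hr skip.
have al : alive (s + n.+1) by rewrite alive_shift as_ hl.
pose G1 t := if t == s + n.+1 then u else G t.
have eG1 t : t < s + n.+1 -> G1 t = G t by move=> ht; rewrite /G1 ltn_eqF.
have e1 : window G1 s.+1 n = window G s.+1 n.
  by apply: eq_window => t; rewrite addSnnS; exact: eG1.
have hr1 : run (window G1 s.+1 n.+1) l'.
  by rewrite window_last al e1 remaining_shift hl /= {1}/G1 eqxx.
have [G' [h1 h2 h3]] := IH _ _ _ hr1 hd'.
have eG' t : t < s + n.+1 -> G' t = G t.
  by move=> ht; rewrite h1 ?eG1 // addSn ltnW.
have eu : G' (s + n.+1) = u by rewrite h1 ?addSn // /G1 eqxx.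
exists G'; split=> //.
  move=> t; rewrite leq_eqVlt => /orP[/eqP <- _|]; last exact: h2.
  rewrite /valid_move eu eG' ?addnS ?ltnS ?leq_addr // hl.
  by rewrite (@eq_window _ G) // => t' ht; apply: eG'; rewrite -addSnnS.
by move=> v; rewrite /= al eu h3 addSn.
Qed.

Definition time (x : abox mu) : nat := row x * n.+1 + col x.

Lemma time_div x : time x %/ n.+1 = row x.
Proof. by rewrite /time divnMDl // divn_small ?addn0. Qed.

Lemma time_mod x : time x %% n.+1 = col x.
Proof. by rewrite /time modnMDl modn_small. Qed.

Lemma time_inj : injective time.
Proof.
move=> x y e; apply: abox_eq; last by rewrite -!time_div e.
by apply: val_inj; rewrite /= -!time_mod e.
Qed.

Lemma tcol_time x : tcol (time x) = col x.
Proof. by rewrite /tcol time_mod inord_val. Qed.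

Lemma alive_time x : alive (time x).
Proof. by rewrite /alive time_div tcol_time row_le. Qed.

Lemma remaining_time x : remaining (time x) = mu (col x) - row x.
Proof. by rewrite /remaining tcol_time time_div. Qed.

Lemma time_below (u : box mu) : time (below u) + n.+1 = time (val u).
Proof. by rewrite /time col_below -row_below mulSn; lia. Qed.

Lemma time_surj t : alive t -> exists x, time x = t.
Proof.
move=> at_; exists (lift_box mu (tcol t) (t %/ n.+1)).
rewrite /time row_lift // col_lift /tcol inordK ?ltn_mod //.
by rewrite -divn_eq.
Qed.

Lemma count_boxes G k v : (forall t, n.+1 + k <= t -> ~~ alive t) ->
  count (fun t => alive t && (G t == v)) (iota n.+1 k) =
  #|[set u : box mu | G (time (val u)) == v]|.
Proof.
move=> hd; rewrite -size_filter cardE -(size_map (time \o val)).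
apply: perm_size; apply: uniq_perm.
- by rewrite filter_uniq // iota_uniq.
- by rewrite map_inj_uniq ?enum_uniq // => x y /time_inj/val_inj.
move=> t; rewrite mem_filter mem_iota; apply/idP/idP.
  move=> /and3P[/andP[at_ Gt] h1 h2]; have [x xt] := time_surj at_.
  have r0 : 0 < row x.
    by rewrite lt0n; apply: contraTneq h1 => r0; rewrite -xt /time r0 mul0n -ltnNge ltn_ord.
  by apply/mapP; exists (Sub x r0) => //; rewrite mem_enum inE /= xt.
move=> /mapP[u]; rewrite mem_enum inE => Gu ->; rewrite /= alive_time Gu /=.
have u0 : 0 < row (val u) := valP u.
have := alive_time (val u); apply: contraLR; rewrite negb_and => /orP[|].
  rewrite -ltnNge /time => h; move: u0; rewrite lt0n => /negP[]; apply/eqP.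
  by move: h; case: (row _) => // m; rewrite mulSn; lia.
by rewrite -leqNgt; exact: hd.
Qed.

End Trace.

Section Contents.
Local Open Scope nat_scope.
Variables (n : nat) (mu : 'I_n.+1 -> nat).
Local Notation row := Defs.row.
Local Notation col := Defs.col.
Implicit Types (sigma : filling mu) (x y : abox mu) (u : box mu).

Definition weight sigma (v : 'I_n.+1) : nat := #|[set u | sigma u == v]|.

Lemma augment_row0 sigma x : row x = 0 -> augment sigma x = col x.
Proof. by move=> r0; rewrite /augment insubF // r0. Qed.

Lemma augment_box sigma u : augment sigma (val u) = sigma u.
Proof. by rewrite /augment valK. Qed.

Lemma attackE x y : time y < time x ->
  attack x y = (time x < time y + n.+1).
Proof.
move=> lt_yx; have ne : x != y by apply: contraTneq lt_yx => ->; rewrite ltnn.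
rewrite /attack ne /=; move: lt_yx; rewrite /time.
have := ltn_ord (col x); have := ltn_ord (col y).
move: (row x) (row y) (col x : nat) (col y : nat) => r r' c c' hc' hc.
case: (ltngtP r r') => [lt|gt|->].
- have : r.+1 * n.+1 <= r' * n.+1 by rewrite leq_mul2r lt orbT.
  by rewrite mulSn; lia.
- have [->|ne'] := eqVneq r r'.+1; first by rewrite mulSn; lia.
  have : r'.+2 * n.+1 <= r * n.+1 by rewrite leq_mul2r; lia.
  by rewrite !mulSn; lia.
- by lia.
Qed.

Lemma attackC x y : attack x y = attack y x.
Proof. by rewrite /attack eq_sym [in row x == row y]eq_sym; congr (_ && _); rewrite [in X in _ || X]orbC. Qed.

(** Here [w], [u], [v] stand for the entries of [below u], [u] and the arm box: meeting [u] before
    [v] on the way down is the triple condition of [coinv_eq0]. *)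
Lemma chi_dist (w u v : 'I_n.+1) : dist w u < dist w v ->
  (v < u) + (w < v) = 1 + (w < u) :> nat.
Proof.
have := ltn_ord u; have := ltn_ord v; have := ltn_ord w.
by rewrite !distE => ? ? ?; do 2!case: ifP => ?; lia.
Qed.

Lemma queue_window : queue mu = window mu (tcol n) 0 n.+1.
Proof.
rewrite /queue /window -val_enum_ord filter_map -map_comp.
have e : all (preim val (alive mu)) (enum 'I_n.+1).
  by apply/allP => i _; rewrite /= /alive divn_small.
rewrite (all_filterP e); apply: eq_map => i /=.
by rewrite /remaining /tcol divn_small // modn_small // inord_val subn0.
Qed.

Lemma run_filling l : run (queue mu) l ->
  exists sigma, [/\ nonattacking sigma, coinv sigma = 0 &
    forall v, count_mem v l = weight sigma v].
Proof.
rewrite queue_window => hr.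
pose k := n.+1 * (\sum_i mu i).+1.
have hd t : k <= t -> ~~ alive mu t.
  move=> kt; rewrite /alive -ltnNge; apply: (@leq_trans (\sum_i mu i).+1).
    by rewrite ltnS (bigD1 (tcol n t)) //= leq_addr.
  by rewrite leq_divRL // mulnC.
have [G [h1 h2 h3]] := run_trace hr hd; rewrite add0n in h1 h3.
pose sigma : filling mu := [ffun u => G (time (val u))].
have aG x : augment sigma x = G (time x).
  have [r0|r0] := posnP (row x).
    rewrite augment_row0 // h1; first by rewrite tcol_time.
    by rewrite /time r0 mul0n add0n.
  rewrite -[x](@SubK _ (fun x => 0 < row x) (box mu) x r0).
  by rewrite augment_box ffunE.
have hwin u y : time (below u) < time y < time (below u) + n.+1 ->
    (G (time y), remaining mu (time y)) \in window mu G (time (below u)).+1 n.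
  move=> hy; apply: map_f; rewrite mem_filter alive_time mem_iota.
  by move: hy; rewrite addSnnS.
have hmove u : valid_move mu G (time (below u)).
  by apply: h2 => //; rewrite time_below alive_time.
exists sigma; split.
- suff late x y : time y < time x -> attack x y -> augment sigma x != augment sigma y.
    apply/forallP => x; apply/forallP => y; apply/implyP => axy.
    case: (ltngtP (time x) (time y)) => [lt|gt|/time_inj e].
    + by rewrite eq_sym; apply: late => //; rewrite attackC.
    + exact: late.
    + by move: axy; rewrite e /attack eqxx.
  move=> lt; rewrite attackE // => near.
  have [r0|r0] := posnP (row x).
    have r0' : row y = 0.
      by move: lt; rewrite /time r0; case: (row y) => // m; rewrite mulSn; have := ltn_ord (col x); lia.
    rewrite !augment_row0 //; apply: contraTneq lt => e.
    by rewrite /time r0 r0' e ltnn.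
  pose u : box mu := Sub x r0; have ux : val u = x by rewrite SubK.
  have tx := time_below u; rewrite ux in tx.
  have := hmove u; rewrite /valid_move tx !aG => /andP[ni _].
  apply: contraNneq ni => ->; apply/mapP.
  by exists (G (time y), remaining mu (time y)) => //; apply: hwin; lia.
- apply: coinv_eq0 => u v huv; rewrite /chi !aG.
  apply: chi_dist; have := hmove u; rewrite /valid_move time_below => /andP[_ /allP].
  have rb := row_below u; have cb := col_below u.
  (* An arm box acts between [below u] and [u], and its particle disappears first, so it is one that
     blocks the move. *)
  have hv : time (below u) < time v < time (below u) + n.+1 /\
      remaining mu (time v) < remaining mu (time (below u)).
    rewrite !remaining_time cb; have := row_le (val u); rewrite -rb; have := row_le v.
    case/orP: huv => /and3P[/eqP rv cv mv].
    + have -> : time v = row (below u) * n.+1 + n.+1 + col v.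
        by rewrite /time rv -rb mulSn; lia.
      rewrite /time cb rv -rb; have := ltn_ord (col (val u)).
      by move: (_ * _) mv cv; lia.
    + rewrite /time cb -(succn_inj (etrans rv (esym rb))); have := ltn_ord (col v).
      by move: (_ * _) mv cv; lia.
  by case: hv => hv hr' /(_ _ (hwin u v hv)) /=; rewrite hr'.
move=> v; rewrite h3 count_boxes; last by move=> t ht; apply: hd; lia.
by rewrite /weight; apply: eq_card => u; rewrite !inE ffunE.
Qed.
End Contents.

(** * Contents of fillings are dominated *)

Section Triangularity.
Local Open Scope nat_scope.
Variables (n : nat) (mu : 'I_n.+1 -> nat).
Local Notation row := Defs.row.
Local Notation col := Defs.col.
Implicit Types (sigma : filling mu) (x y : abox mu) (u : box mu).

(** The shift by [n.+1] skips the times of row 0. *)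
Lemma thr_time c (i : 'I_n.+1) j :
  (c + n.+1 <= j * n.+1 + i) = (thr c i < j).
Proof.
rewrite /thr {1}(divn_eq c n.+1); have := ltn_ord i; have := ltn_pmod c (ltn0Sn n).
move: (c %/ _) (c %% _) (nat_of_ord i) => q r k hr hk.
have [lt|] := leqP j q.
  have : j * n.+1 <= q * n.+1 by rewrite leq_mul2r lt orbT.
  by case: (k < r); lia.
rewrite leq_eqVlt => /orP[/eqP <-|lt]; first by rewrite mulSn; case: ltnP; lia.
have : q.+2 * n.+1 <= j * n.+1 by rewrite leq_mul2r lt orbT.
by rewrite !mulSn; case: ltnP; lia.
Qed.

Lemma card_column (i : 'I_n.+1) k :
  #|[set u : box mu | (col (val u) == i) && (k < row (val u))]| = mu i - k.
Proof.
rewrite cardE -(size_map (fun u : box mu => row (val u))) -(size_iota k.+1 (mu i - k)).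
apply: perm_size; apply: uniq_perm; last 1 first.
- move=> j; rewrite mem_iota; apply/mapP/idP.
    move=> [u]; rewrite mem_enum inE => /andP[/eqP ci hk] ->.
    have := row_le (val u); rewrite ci; move: hk; move: (row _) => r hk hr.
    by rewrite hk; lia.
  move=> hj; have r : row (lift_box mu i j) = j by rewrite row_lift; lia.
  have r0 : 0 < row (lift_box mu i j) by rewrite r; lia.
  exists (Sub (lift_box mu i j) r0); last by rewrite SubK r.
  by rewrite mem_enum inE SubK r col_lift eqxx; lia.
- rewrite map_inj_in_uniq ?enum_uniq // => u v.
  rewrite !mem_enum !inE => /andP[/eqP cu _] /andP[/eqP cv _] e.
  by apply: val_inj; apply: abox_eq; rewrite ?cu ?cv.
- exact: iota_uniq.
Qed.

Lemma card_late c :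
  #|[set u : box mu | c + n.+1 <= time (val u)]| = excess c mu.
Proof.
rewrite -sum1_card (partition_big (fun u : box mu => col (val u)) predT) //=.
apply: eq_bigr => i _; rewrite -card_column -sum1_card; apply: eq_bigl => u.
by rewrite !inE andbC; case: eqP => //= <-; rewrite /time thr_time.
Qed.

Lemma landing_gap sigma x y : nonattacking sigma -> time y < time x ->
  augment sigma x = augment sigma y -> time y + n.+1 <= time x.
Proof.
move=> /forallP/(_ x)/forallP/(_ y) na lt e; rewrite leqNgt -(attackE lt).
by move: na; rewrite e eqxx implybF.
Qed.

(** Landings on [v] are at least a lap apart and the basement already holds [v] at time [v], so [f]
    is injective with values from 1 on. *)
Lemma card_early sigma c v : nonattacking sigma ->
  #|[set u | (sigma u == v) && (time (val u) < c + n.+1)]| <= thr c v.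
Proof.
move=> na; pose f u := (time (val u) - v) %/ n.+1.
have base u : sigma u = v -> v + n.+1 <= time (val u).
  move=> su; have tb : time (lift_box mu v 0) = v by rewrite /time row_lift // mul0n.
  rewrite -tb; apply: landing_gap na _ _.
    rewrite tb; apply: leq_trans (ltn_ord v) _; rewrite /time.
    by rewrite -(row_below u) mulSn -addnA leq_addr.
  by rewrite augment_box su augment_base.
rewrite cardE -(size_map f) -(size_iota 1 (thr c v)).
apply: uniq_leq_size.
  rewrite map_inj_in_uniq ?enum_uniq // => u w.
  rewrite !mem_enum !inE => /andP[/eqP su _] /andP[/eqP sw _].
  have step (u1 u2 : box mu) : sigma u1 = v -> sigma u2 = v ->
      time (val u1) < time (val u2) -> f u1 < f u2.
    move=> s1 s2 lt; have g := landing_gap na lt; have b1 := base _ s1.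
    rewrite /f -div_shift leq_div2r //.
    by have := g _; rewrite !augment_box s1 s2 => /(_ erefl); lia.
  case: (ltngtP (time (val u)) (time (val w))) => [lt|gt|/time_inj/val_inj //] e.
    by have := step _ _ su sw lt; rewrite e ltnn.
  by have := step _ _ sw su gt; rewrite e ltnn.
move=> j /mapP[u]; rewrite mem_enum inE => /andP[/eqP su early] ->.
have b := base _ su; rewrite mem_iota add1n ltnS; apply/andP; split.
  by rewrite /f leq_divRL // mul1n; lia.
rewrite leqNgt -thr_time -ltnNge; apply: leq_ltn_trans early.
have := leq_trunc_div (time (val u) - v) n.+1; rewrite -/(f u).
move: b; move: (time _) (_ * _); clear; lia.
Qed.

Lemma weight_dominated sigma : nonattacking sigma -> dominated (weight sigma) mu.
Proof.
move=> na; split.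
  have <- : excess 0 mu = \sum_i mu i by exact: excess0.
  rewrite -card_late -sum1_card (partition_big sigma predT) //=.
  apply: eq_bigr => v _; rewrite /weight -sum1_card; apply: eq_bigl => u.
  rewrite !inE (leq_trans _ (_ : n.+1 <= time (val u))) //.
  by rewrite /time -(row_below u) mulSn -addnA leq_addr.
move=> c; rewrite -card_late -sum1_card (partition_big sigma predT) //=.
apply: leq_sum => v _; rewrite leq_subLR.
have -> : \sum_(u in [set u : box mu | c + n.+1 <= time (val u)] | sigma u == v) 1 =
    #|[set u | (sigma u == v) && (c + n.+1 <= time (val u))]|.
  by rewrite -sum1_card; apply: eq_bigl => u; rewrite !inE andbC.
apply: leq_trans (leq_add (card_early c v na) (leqnn _)).
rewrite /weight -(cardsID [set u | time (val u) < c + n.+1]).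
apply: eq_leq; congr (_ + _); apply: eq_card => u; rewrite !inE //.
by rewrite -leqNgt andbC.
Qed.

End Triangularity.

(** * The support at t = 0 *)

Section Support.
Local Open Scope ring_scope.
Variables (n : nat) (mu : 'I_n.+1 -> nat).
Implicit Types (sigma : filling mu).

Definition weight_mnm sigma : 'X_{1..n.+1} := [multinom weight sigma v | v < n.+1].

Lemma prod_filling (K : fieldType) sigma :
  \prod_(u : box mu) 'X_(sigma u) = 'X_[K, weight_mnm sigma].
Proof.
rewrite -(big_morph _ (@mpolyXD n.+1 K) (@mpolyX0 n.+1 K)); congr (mpolyX _ _).
apply/mnmP => v; rewrite mnm_sumE mnmE /weight -sum1dep_card [RHS]big_mkcond /=.
by apply: eq_bigr => u _; rewrite mnm1E; case: eqP.
Qed.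

Lemma macdonaldE_t0 (K : fieldType) (q : K) :
  macdonaldE mu q 0 =
  \sum_(sigma : filling mu | nonattacking sigma && (coinv sigma == 0))
    q ^+ maj sigma *: 'X_[weight_mnm sigma].
Proof.
rewrite /macdonaldE [RHS]big_mkcondr /=; apply: eq_bigr => sigma _.
rewrite prod_filling exp0rz big1 ?mulr1; last first.
  by move=> u _; rewrite expr0n mulr0 !subr0 divr1.
by case: eqP; rewrite ?mulr1 // mulr0 scale0r.
Qed.

(** The coefficient is a sum of powers of [q] whose value at 1 counts the fillings, so nothing
    cancels. *)
Lemma mcoeff_demazureE m : (demazureE mu)@_m != 0 <->
  exists sigma, [/\ nonattacking sigma, coinv sigma = 0 & weight_mnm sigma = m].
Proof.
pose p : {poly rat} := \sum_(sigma : filling mu | (nonattacking sigma && (coinv sigma == 0))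
   && (weight_mnm sigma == m)) 'X^(maj sigma).
have -> : (demazureE mu)@_m = tofrac p.
  rewrite /demazureE macdonaldE_t0 raddf_sum /= rmorph_sum /= [RHS]big_mkcondr /=.
  apply: eq_bigr => sigma _; rewrite mcoeffZ mcoeffX.
  by case: eqP; rewrite ?mulr1 ?mulr0 // rmorphXn.
have p1 : p.[1] = #|[pred sigma : filling mu | (nonattacking sigma && (coinv sigma == 0))
   && (weight_mnm sigma == m)]|%:R.
  rewrite /p horner_sum -sum1_card natr_sum; apply: eq_bigr => sigma _.
  by rewrite hornerXn expr1n.
rewrite tofrac_eq0; split=> [p0|[sigma [h1 h2 h3]]].
  have [sigma|none] := pickP [pred sigma : filling mu |
     (nonattacking sigma && (coinv sigma == 0)) && (weight_mnm sigma == m)].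
    by move=> /= /andP[/andP[h1 /eqP h2] /eqP h3]; exists sigma.
  by move: p0; rewrite /p big_pred0 ?eqxx.
apply: contra_eq_neq p1 => ->; rewrite horner0 eq_sym pnatr_eq0 -lt0n.
by apply/card_gt0P; exists sigma; rewrite inE h1 h2 h3 !eqxx.
Qed.

Lemma supp_demazureE (a : 'rV[int]_n.+1) : supp (demazureE mu) a <->
  exists2 beta, dominated beta mu & a = \row_i (beta i)%:Z.
Proof.
split=> [[m /mcoeff_demazureE[sigma [na _ <-]] <-]|[beta d ->]].
  exists (weight sigma); first exact: weight_dominated.
  by apply/rowP => i; rewrite !mxE mnmE.
have [l hl cl] := dominated_reaches d; have [sigma [na c0 cw]] := run_filling hl.
exists (weight_mnm sigma); first by apply/mcoeff_demazureE; exists sigma.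
by apply/rowP => i; rewrite !mxE mnmE -cw cl.
Qed.
End Support.

(** * M-convexity *)

Section Exchange.
Local Open Scope nat_scope.
Variables (n : nat) (mu : 'I_n.+1 -> nat).
Implicit Types (u v beta : 'I_n.+1 -> nat) (I J : {set 'I_n.+1}).

Definition capacity c I : nat := excess c mu + \sum_(k in I) thr c k.

Definition tight beta c I : Prop := \sum_(k in I) beta k = capacity c I.

(** For fixed [c] the strongest inequality is that of the set where [thr c k < beta k]; it is the
    bound on positive parts. *)
Lemma dominatedP beta : dominated beta mu <->
  \sum_k beta k = \sum_k mu k /\ forall c I, \sum_(k in I) beta k <= capacity c I.
Proof.
split=> -[h1 h2]; split=> // c.
  move=> I; apply: leq_trans (leq_add (h2 c) (leqnn _)).
  rewrite /excess [X in _ <= X + _](bigID (mem I)) /= addnAC -big_split /=.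
  apply: leq_trans (leq_addr _ _); apply: leq_sum => k _.
  by rewrite addnC -leq_subLR.
pose J := [set k | thr c k < beta k].
have e1 : excess c beta = \sum_(k in J) (beta k - thr c k).
  rewrite /excess (bigID (mem J)) /= [X in _ + X]big1 ?addn0 // => k.
  by rewrite inE -leqNgt -subn_eq0 => /eqP.
have e2 : \sum_(k in J) beta k = \sum_(k in J) (beta k - thr c k) + \sum_(k in J) thr c k.
  by rewrite -big_split; apply: eq_bigr => k; rewrite inE /= => /ltnW h; rewrite subnK.
by have := h2 c J; rewrite /capacity e1 e2 leq_add2r.
Qed.

Lemma thr_mono c c' (i : 'I_n.+1) : c <= c' -> thr c i <= thr c' i.
Proof.
move=> /subnKC <-; elim: (c' - c) => [|d IH]; first by rewrite addn0.
by rewrite addnS thrS; apply: leq_trans IH (leq_addr _ _).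
Qed.

Lemma sum_setUI (F : 'I_n.+1 -> nat) I J :
  \sum_(k in I :|: J) F k + \sum_(k in I :&: J) F k =
  \sum_(k in I) F k + \sum_(k in J) F k.
Proof.
rewrite (big_setID I) /= finset.setUK finset.setDUl finset.setDv finset.set0U -addnA; congr (_ + _).
by rewrite [in RHS](big_setID I) /= [RHS]addnC finset.setIC.
Qed.

(** With the union at the smaller index, the sides differ only on [J :\: I], where [thr] grows with
    the index. *)
Lemma capacity_submod c c' I J : c <= c' ->
  capacity c (I :|: J) + capacity c' (I :&: J) <= capacity c I + capacity c' J.
Proof.
move=> cc; rewrite /capacity [leqLHS]addnACA [leqRHS]addnACA leq_add2l.
rewrite (big_setID I) /= finset.setUK finset.setDUl finset.setDv finset.set0U -addnA leq_add2l.
rewrite [leqRHS](big_setID I) /= [leqRHS]addnC finset.setIC leq_add2r.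
by apply: leq_sum => k _; exact: thr_mono.
Qed.

Lemma capacity_uncross c c' I J : exists c1 c2,
  capacity c1 (I :|: J) + capacity c2 (I :&: J) <= capacity c I + capacity c' J.
Proof.
have [cc|cc] := leqP c c'; first by exists c, c'; exact: capacity_submod.
exists c', c; rewrite finset.setUC finset.setIC [leqRHS]addnC; apply: capacity_submod; exact: ltnW.
Qed.

Lemma tight_uncross beta c c' I J : dominated beta mu ->
  tight beta c I -> tight beta c' J ->
  (exists c1, tight beta c1 (I :|: J)) /\ (exists c2, tight beta c2 (I :&: J)).
Proof.
move=> /dominatedP[_ h] tI tJ; have [c1 [c2]] := capacity_uncross c c' I J.
have := h c1 (I :|: J); have := h c2 (I :&: J); have := sum_setUI beta I J.
rewrite /tight in tI tJ *; rewrite tI tJ => e h2 h1 h3.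
by split; [exists c1|exists c2]; lia.
Qed.

Lemma sum_setT (F : 'I_n.+1 -> nat) : \sum_(k in [set: 'I_n.+1]) F k = \sum_k F k.
Proof. by apply: eq_bigl => k; rewrite finset.in_setT. Qed.

Definition shift beta i j (k : 'I_n.+1) : nat := beta k - (k == i) + (k == j).

Lemma sum_shift beta i j I : 0 < beta i ->
  \sum_(k in I) shift beta i j k + (i \in I) = \sum_(k in I) beta k + (j \in I).
Proof.
move=> bi; have e (l : 'I_n.+1) : \sum_(k in I) (k == l : nat) = (l \in I).
  case h : (l \in I).
    by rewrite (bigD1 l) //= eqxx big1 ?addn0 // => k /andP[_ /negbTE ->].
  by rewrite big1 // => k; case: eqP => // ->; rewrite h.
rewrite -!e -!big_split /=; apply: eq_bigr => k _.
rewrite /shift; case: (eqVneq k i) => [->|_]; last by rewrite subn0 addn0.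
by rewrite addnAC subnK.
Qed.

Lemma dominated_shift beta i j : dominated beta mu -> 0 < beta i ->
  (forall c J, j \in J -> i \notin J -> ~ tight beta c J) ->
  dominated (shift beta i j) mu.
Proof.
move=> /dominatedP[h1 h2] bi nt; apply/dominatedP; split.
  have := sum_shift j [set: 'I_n.+1] bi; rewrite !inE -h1.
  by rewrite !sum_setT; lia.
move=> c J; have := sum_shift j J bi; have := h2 c J; have := nt c J.
rewrite /tight; case: (j \in J); case: (i \in J) => /= h; try lia.
Qed.

(** Take a smallest set [D] containing [i] and tight for [v], and a largest set [X] avoiding [i] and
    tight for [u]. Uncrossing them yields [j] in [D] outside [X]; a constraint obstructing a shift
    would enlarge [X] or shrink [D]. *)
Lemma exchange u v i : dominated u mu -> dominated v mu -> v i < u i ->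
  exists j, [/\ i != j, u j < v j, dominated (shift u i j) mu & dominated (shift v j i) mu].
Proof.
move=> du dv vu; have [hu1 hu2] := (dominatedP u).1 du; have [hv1 hv2] := (dominatedP v).1 dv.
pose PD (D : {set 'I_n.+1}) := (i \in D) && `[< exists c, tight v c D >].
pose PX (X : {set 'I_n.+1}) := (i \notin X) && `[< exists c, tight u c X >].
have PDT : PD [set: 'I_n.+1].
  rewrite /PD inE; apply/asboolP; exists 0; rewrite /tight /capacity excess0 -hv1.
  by rewrite !sum_setT (eq_bigr (fun=> 0) (fun k _ => thr0 k)) big1_eq addn0.
have PX0 : PX finset.set0.
  (* At this index every threshold is the total of [mu], so the excess vanishes. *)
  rewrite /PX inE; apply/asboolP; exists (n.+1 * \sum_k mu k).
  rewrite /tight /capacity !finset.big_set0 addn0 /excess big1 // => k _.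
  apply/eqP; rewrite subn_eq0 /thr mulKn // (bigD1 k) //= -addnA leq_addr //.
have [D /andP[iD /asboolP[cD tD]] minD] := @arg_minnP _ [set: 'I_n.+1] PD (fun D => #|D|) PDT.
have [X /andP[iX /asboolP[cX tX]] maxX] := @arg_maxnP _ finset.set0 PX (fun D => #|D|) PX0.
have [j /andP[jD jX] uvj] : exists2 j, (j \in D) && (j \notin X) & u j < v j.
  apply/exists_inP; apply: contraT; rewrite negb_exists_in => /forall_inP none.
  have [c1 [c2]] := capacity_uncross cX cD X D; rewrite -tX -tD.
  have := hu2 c1 (X :|: D); have := hv2 c2 (X :&: D).
  have := sum_setUI u X D.
  have split_sum F : \sum_(k in D) F k = \sum_(k in X :&: D) F k + \sum_(k in D :\: X) F k.
    by rewrite finset.setIC; exact: big_setID.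
  rewrite (split_sum u) (split_sum v).
  suff : \sum_(k in D :\: X) v k < \sum_(k in D :\: X) u k by lia.
  have iDX : i \in D :\: X by rewrite inE iX iD.
  rewrite (bigD1 i) //= [ltnRHS](bigD1 i) //= -addSn leq_add //.
  apply: leq_sum => k /andP[]; rewrite inE => /andP[kX kD] _.
  by rewrite leqNgt none // kD kX.
have ij : i != j by apply: contraTneq uvj => <-; rewrite -leqNgt ltnW.
exists j; split=> //.
  apply: dominated_shift => //; first by apply: leq_ltn_trans vu.
  move=> c J jJ iJ tJ; have [[c1 t1] _] := tight_uncross du tX tJ.
  have : PX (X :|: J).
    by rewrite /PX inE negb_or iX iJ; apply/asboolP; exists c1.
  move=> /maxX le; have : X :|: J == X by rewrite eq_sym eqEcard finset.subsetUl.
  by move/eqP/setP/(_ j); rewrite inE jJ orbT (negbTE jX).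
apply: dominated_shift => //; first by apply: leq_ltn_trans uvj.
move=> c J iJ jJ tJ; have [_ [c2 t2]] := tight_uncross dv tD tJ.
have : PD (D :&: J) by rewrite /PD inE iD iJ; apply/asboolP; exists c2.
move=> /minD le; have : D :&: J == D by rewrite eqEcard finset.subsetIl.
by move/eqP/setP/(_ j); rewrite inE jD (negbTE jJ).
Qed.

End Exchange.

(** * Convex hulls and their vertices *)

Section Polytope.
Local Open Scope ring_scope.
Local Open Scope classical_set_scope.
Variables (R : realType) (n : nat).
Implicit Types (A B : set 'rV[R]_n) (c x y : 'rV[R]_n).
Local Notation conv := Defs.conv.

Lemma conv_sub A B : A `<=` B ->
  (forall x y (t : R), 0 <= t -> t <= 1 -> B x -> B y -> B (t *: x + (1 - t) *: y)) ->
  conv A `<=` B.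
Proof.
move=> AB cB; apply: smallest_sub => // x y t; rewrite !inE => Bx By.
exact: (cB x y t%:num (ge0 t) (le1 t)).
Qed.

Lemma sub_conv A : A `<=` conv A. Proof. exact: sub_gen_smallest. Qed.

Lemma dotD c x y : dot c (x + y) = dot c x + dot c y.
Proof. by rewrite /dot -big_split; apply: eq_bigr => i _; rewrite mxE mulrDr. Qed.

Lemma dotZ c t x : dot c (t *: x) = t * dot c x.
Proof. by rewrite /dot mulr_sumr; apply: eq_bigr => i _; rewrite mxE mulrCA. Qed.

Lemma conv_dot_le A c t : (forall x, A x -> dot c x <= t) ->
  forall x, conv A x -> dot c x <= t.
Proof.
move=> h; apply: conv_sub => // x y s s0 s1 hx hy /=.
by rewrite dotD !dotZ; nra.
Qed.

Lemma conv_dot_lt A c t : (forall x, A x -> dot c x < t) ->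
  forall x, conv A x -> dot c x < t.
Proof.
move=> h; apply: conv_sub => // x y s s0 s1 hx hy /=; rewrite dotD !dotZ.
have [->|sN0] := eqVneq s 0; first by rewrite mul0r add0r subr0 mul1r.
have : 0 < s * (t - dot c x) by rewrite mulr_gt0 ?subr_gt0 // lt0r sN0.
have : 0 <= (1 - s) * (t - dot c y) by rewrite mulr_ge0 ?subr_ge0 // ltW.
by nra.
Qed.

(** Otherwise the functional exposing [x] is strictly smaller on [A], hence on the whole hull,
    including [x]. *)
Lemma vertex_conv A x : vertex (conv A) x -> A x.
Proof.
case=> c e; have [Px hx] : [set z | conv A z /\ forall y, conv A y -> dot c y <= dot c z] x.
  by rewrite -e.
apply: contrapT => nAx; suff : dot c x < dot c x by rewrite ltxx.
apply: (conv_dot_lt (A := A)) => // y Ay; have Py := sub_conv Ay.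
rewrite lt_neqAle hx // andbT; apply/eqP => eyx.
have : [set x] y by rewrite e; split=> // z Pz; rewrite eyx; exact: hx.
by move=> /= yx; apply: nAx; rewrite -yx.
Qed.

Lemma conv_pair x y z : conv [set x; y] z -> exists t : R, z = x + t *: (y - x).
Proof.
move: z; apply: (conv_sub (B := fun z => exists t : R, z = x + t *: (y - x))).
  move=> z /= [->|->]; first by exists 0; rewrite scale0r addr0.
  by exists 1; rewrite scale1r addrC subrK.
move=> _ _ t _ _ [s1 ->] [s2 ->]; exists (t * s1 + (1 - t) * s2).
rewrite (scalerDr t) (scalerDr (1 - t)) !scalerA addrACA -!scalerDl.
by rewrite (addrC t) subrK scale1r.
Qed.

End Polytope.

(** * The hull of the dominated vectors *)

Section MConvexity.
Local Open Scope ring_scope.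
Local Open Scope classical_set_scope.
Variables (R : realType) (n : nat) (mu : 'I_n.+1 -> nat).
Local Notation conv := Defs.conv.
Local Notation vec beta := (\row_(i < n.+1) (beta i)%:Z).
Local Notation pt beta := (of_int R (vec beta)).

Definition dominated_vectors : set 'rV[int]_n.+1 :=
  [set a | exists2 beta, dominated beta mu & a = vec beta].

Local Notation P := (conv (@of_int R n.+1 @` dominated_vectors)).

Definition indicator (I : {set 'I_n.+1}) : 'rV[R]_n.+1 := \row_i (i \in I)%:R.

Lemma dot_indicator (I : {set 'I_n.+1}) (x : 'rV[R]_n.+1) :
  dot (indicator I) x = \sum_(i in I) x 0 i.
Proof.
rewrite /dot [RHS]big_mkcond; apply: eq_bigr => i _; rewrite mxE.
by case: (i \in I); rewrite ?mul1r ?mul0r.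
Qed.

Lemma dot_pt (I : {set 'I_n.+1}) beta :
  dot (indicator I) (pt beta) = (\sum_(i in I) beta i)%N%:R.
Proof. by rewrite dot_indicator natr_sum; apply: eq_bigr => i _; rewrite !mxE. Qed.

Lemma dotN (c x : 'rV[R]_n.+1) : dot (- c) x = - dot c x.
Proof. by rewrite /dot -sumrN; apply: eq_bigr => i _; rewrite mxE mulNr. Qed.

(** The linear constraints of [dominatedP], together with nonnegativity, pass to the hull, and
    integer points satisfying them are dominated. *)
Lemma lattice_points (a : 'rV[int]_n.+1) : P (of_int R a) -> dominated_vectors a.
Proof.
move=> Pa.
have up (I : {set 'I_n.+1}) (N : nat) :
    (forall beta, dominated beta mu -> (\sum_(i in I) beta i <= N)%N) ->
    \sum_(i in I) (a 0 i)%:~R <= N%:R :> R.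
  move=> h; rewrite (eq_bigr (fun i => of_int R a 0 i)); last by move=> i _; rewrite mxE.
  rewrite -dot_indicator; apply: conv_dot_le Pa => _ [_ [beta d ->] <-].
  by rewrite dot_pt ler_nat h.
have lo (I : {set 'I_n.+1}) (N : nat) :
    (forall beta, dominated beta mu -> (N <= \sum_(i in I) beta i)%N) ->
    N%:R <= \sum_(i in I) (a 0 i)%:~R :> R.
  move=> h; rewrite (eq_bigr (fun i => of_int R a 0 i)); last by move=> i _; rewrite mxE.
  rewrite -dot_indicator -lerN2 -dotN; apply: conv_dot_le Pa => _ [_ [beta d ->] <-].
  by rewrite dotN lerN2 dot_pt ler_nat h.
have a0 i : 0 <= a 0 i.
  have := lo [set i]%SET 0%N (fun _ _ => isT).
  by rewrite big_set1 ler0z.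
pose beta i := absz (a 0 i).
have ab i : a 0 i = (beta i)%:Z by rewrite /beta gez0_abs.
have sumE (I : {set 'I_n.+1}) :
    \sum_(i in I) (a 0 i)%:~R = (\sum_(i in I) beta i)%N%:R :> R.
  by rewrite natr_sum; apply: eq_bigr => i _; rewrite ab.
exists beta; last by apply/rowP => i; rewrite mxE ab.
apply/dominatedP; split; last first.
  by move=> c I; rewrite -(ler_nat R) -sumE up // => b /dominatedP[].
apply/eqP; rewrite eqn_leq -!(sum_setT beta) -!(ler_nat R) -!sumE.
by rewrite up ?lo // => b /dominatedP[<- _]; rewrite sum_setT.
Qed.

Lemma finite_dominated : exists s : seq 'rV[R]_n.+1,
  @of_int R n.+1 @` dominated_vectors = [set` s].
Proof.
pose N := (\sum_i mu i)%N.
pose g (f : {ffun 'I_n.+1 -> 'I_N.+1}) (i : 'I_n.+1) : nat := f i.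
exists [seq pt (g f) | f <- enum {ffun 'I_n.+1 -> 'I_N.+1} & `[< dominated (g f) mu >]].
apply/seteqP; split=> [_ [_ [beta d ->] <-]|x /mapP[f]].
  have b i : (beta i < N.+1)%N.
    by have [e _] := d; rewrite ltnS /N -e (bigD1 i) //= leq_addr.
  have gb : g [ffun i => inord (beta i)] = beta.
    by apply/funext => i; rewrite /g ffunE inordK.
  apply/mapP; exists [ffun i => inord (beta i)]; last by rewrite gb.
  by rewrite mem_filter mem_enum andbT gb; apply/asboolP.
rewrite mem_filter => /andP[/asboolP d _] ->.
by exists (vec (g f)) => //; exists (g f).
Qed.

Lemma pt_shift beta (i j : 'I_n.+1) : i != j -> (0 < beta i)%N ->
  pt (shift beta i j) = pt beta + (delta_mx 0 j - delta_mx 0 i).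
Proof.
move=> ij bi; apply/rowP => k; rewrite !mxE /shift eqxx /= -!pmulrn.
rewrite natrD natrB; last by case: eqP => [->|].
by rewrite -addrA; congr (_ + _); rewrite addrC.
Qed.

(** An exchange between the endpoints keeps their sum, so the functional defining the edge is also
    maximal at the shifted [u]. That point lies on the line through the endpoints, which gives the
    direction. *)
Lemma adjacent_direction (u v : 'rV[R]_n.+1) : adjacent P u v ->
  exists (i j : 'I_n.+1) (k : R), u - v = k *: (delta_mx 0 i - delta_mx 0 j).
Proof.
case=> /vertex_conv[_ [bu du ->] <-] /vertex_conv[_ [bv dv ->] <-] uv [c eF].
have memP b : dominated b mu -> P (pt b).
  by move=> d; apply: sub_conv; exists (vec b) => //; exists b.
have [i lt] : exists i, (bv i < bu i)%N.
  apply/existsP; apply: contra_notT uv => /existsPn h.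
  have e i : bu i = bv i.
    have le k : (bu k <= bv k)%N by rewrite leqNgt h.
    have [eu _] := du; have [ev _] := dv.
    have : (\sum_k (bv k - bu k) == 0)%N.
      by rewrite sumnB // ev eu subnn.
    rewrite sum_nat_eq0 => /forallP/(_ i); rewrite subn_eq0 /= => ge.
    by apply/eqP; rewrite eqn_leq le.
  by congr of_int; apply/rowP => k; rewrite !mxE e.
have [j [ij uvj du' dv']] := exchange du dv lt.
have bi : (0 < bu i)%N by apply: leq_ltn_trans lt.
have bj : (0 < bv j)%N by apply: leq_ltn_trans uvj.
have [Pu hu] : [set x | P x /\ forall y, P y -> dot c y <= dot c x] (pt bu).
  by rewrite -eF; apply: sub_conv; left.
have [Pv hv] : [set x | P x /\ forall y, P y -> dot c y <= dot c x] (pt bv).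
  by rewrite -eF; apply: sub_conv; right.
have Pu' := memP _ du'; have Pv' := memP _ dv'.
have su := pt_shift ij bi; have sv := @pt_shift bv j i; rewrite eq_sym in sv.
have {}sv := sv ij bj.
have top : dot c (pt (shift bu i j)) = dot c (pt bu).
  apply/eqP; rewrite eq_le hu //=.
  have := hu _ Pv'; have := hv _ Pu; have := hu _ Pv.
  have dN x : dot c (- x) = - dot c x by rewrite -scaleN1r dotZ mulN1r.
  rewrite su sv !dotD !dN.
  by lra.
have : conv [set pt bu; pt bv] (pt (shift bu i j)).
  by rewrite eF; split=> // y /hu; rewrite top.
move=> /conv_pair[t]; rewrite su => /addrI e.
exists i, j, t^-1; have t0 : t != 0.
  apply: contraTneq isT => t0; move: e; rewrite t0 scale0r => /rowP/(_ j).
  rewrite !mxE !eqxx eq_sym (negbTE ij) subr0 => /eqP; by rewrite oner_eq0.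
by rewrite -opprB -[X in - X]opprB -[delta_mx 0 i - _]opprB e -scalerN scalerA mulVf ?scale1r ?opprB.
Qed.

Lemma dominated_M_convex : M_convex R dominated_vectors.
Proof.
exists P; split; last first.
- apply/seteqP; split=> a; last exact: lattice_points.
  by move=> da; apply: sub_conv; exists a.
- by move=> v /vertex_conv[a _ <-]; exists a.
split; last exact: adjacent_direction.
by have [s ->] := finite_dominated; exists s.
Qed.

End MConvexity.

Theorem corollary1p2 (R : realType) (n : nat) (hn : (1 <= n)%N) (mu : 'I_n -> nat) :
  M_convex R (supp (demazureE mu)) /\
  saturated_newton_polytope R (demazureE mu).
Proof.
case: n hn mu => // n _ mu.
have e : supp (demazureE mu) = dominated_vectors mu.
  by apply/seteqP; split=> a /supp_demazureE.
rewrite /saturated_newton_polytope e; split; first exact: dominated_M_convex.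
apply/seteqP; split=> a; first exact: lattice_points.
by move=> da; apply: sub_conv; exists a.
Qed.
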